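(* Let $\triangle ABC$ be a triangle. Let $AA_1, AA_2$ be the two trisectors of the angle at $A$, let $BB_1, BB_2$ be the two trisectors of the angle at $B$, and let $CC_1, CC_2$ be the two trisectors of the angle at $C$, labelled so that $BB_1$ and $CC_2$ are the trisectors adjacent to side $BC$, $CC_1$ and $AA_2$ are the trisectors adjacent to side $CA$, and $AA_1$ and $BB_2$ are the trisectors adjacent to side $AB$. For $i\in\{1,2\}$ put $X_i = BB_i \cap CC_i$, $Y_i = AA_i \cap CC_i$, $Z_i = AA_i \cap BB_i$. Then there exist a conic $\mathcal C_1$ passing through the six points $X_1, Y_1, Z_1, X_2, Y_2, Z_2$ and a conic $\mathcal C_2$ touching the six lines $AA_1, AA_2, BB_1, BB_2, CC_1, CC_2$, so that $X_1Y_1Z_1$ and $X_2Y_2Z_2$ are two closed Poncelet chains for the pair $\mathcal C_1$, $\mathcal C_2$. Consequently, for every starting point on $\mathcal C_1$ the corresponding Poncelet chain for $\mathcal C_1$, $\mathcal C_2$ closes up in three steps; in particular, there are infinitely many triangles inscribed in $\mathcal C_1$ and circumscribed around $\mathcal C_2$.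
   Context: The trisectors of an angle of a triangle are the two rays emanating from the corresponding vertex that divide the angle into three equal parts; each trisector is adjacent to the side of the angle it is closest to. The points $A_1, A_2$ lie on side $BC$, $B_1, B_2$ on side $CA$, and $C_1, C_2$ on side $AB$. In tangency statements the trisectors are regarded as full lines. Given two plane conics $\mathcal C_1$ and $\mathcal C_2$, a Poncelet chain $P_1P_2\ldots P_n\ldots$ is a broken line whose vertices $P_1, P_2,\ldots$ lie on $\mathcal C_1$ and whose links $P_1P_2, P_2P_3,\ldots$, or their continuations, touch $\mathcal C_2$; it closes up in $n$ steps if $P_{n+1}=P_1$. A triangle is circumscribed around $\mathcal C_2$ if its three sidelines are tangent to $\mathcal C_2$. *)

(* Defs.v *)
(* Stdlib's classical real numbers; the Euclidean plane is R * R. *)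
From Stdlib Require Export Reals Ensembles Finite_sets.
Open Scope R_scope.

Definition point : Type := (R * R)%type.

Definition collinear (P Q T : point) : Prop :=
  (fst Q - fst P) * (snd T - snd P) - (snd Q - snd P) * (fst T - fst P) = 0.

(* This is a line only when P <> Q. *)
Definition line (P Q : point) : Ensemble point := fun T => collinear P Q T.

Definition segment (P Q : point) : Ensemble point := fun T =>
  exists t : R, 0 <= t <= 1 /\
    T = ((1 - t) * fst P + t * fst Q, (1 - t) * snd P + t * snd Q).

(* Unoriented angle PQT at the vertex Q, in [0, PI]. *)
Definition angle (P Q T : point) : R :=
  acos (((fst P - fst Q) * (fst T - fst Q) + (snd P - snd Q) * (snd T - snd Q))
        / (dist_euc (fst Q) (snd Q) (fst P) (snd P)
           * dist_euc (fst Q) (snd Q) (fst T) (snd T))).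

(* The trisectors VT1 and VT2 of the angle PVQ of a triangle VPQ, given by
   their points T1, T2 on the side PQ; VT1 is the one adjacent to VP and VT2
   the one adjacent to VQ. *)
Definition trisectors (V P Q T1 T2 : point) : Prop :=
  segment P Q T1 /\ segment P Q T2 /\
  angle P V T1 = angle P V Q / 3 /\
  angle T1 V T2 = angle P V Q / 3 /\
  angle T2 V Q = angle P V Q / 3.

(* A non-degenerate conic
     cxx x^2 + cxy x y + cyy y^2 + cx x + cy y + c0 = 0.
   The quantity required to be non-zero is 4 times the determinant of the
   symmetric matrix of the homogenized equation.  Conics without real points
   are not excluded here. *)
Record conic : Type := Conic {
  cxx : R; cxy : R; cyy : R; cx : R; cy : R; c0 : R;
  conic_nondegenerate :
    4 * cxx * cyy * c0 + cxy * cx * cy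
      - cxx * cy ^ 2 - cyy * cx ^ 2 - c0 * cxy ^ 2 <> 0
}.

Definition on_conic (K : conic) : Ensemble point := fun T =>
  cxx K * fst T ^ 2 + cxy K * fst T * snd T + cyy K * snd T ^ 2
    + cx K * fst T + cy K * snd T + c0 K = 0.

(* The line PQ (P <> Q) touches K: it is the tangent to K at one of its
   points T, that is, the gradient at T of the equation of K (which does not
   vanish, as K is non-degenerate) is orthogonal to the direction of PQ.  The
   point of contact is an ordinary point, so asymptotes do not count. *)
Definition touches (P Q : point) (K : conic) : Prop :=
  P <> Q /\
  exists T : point, line P Q T /\ on_conic K T /\
    (2 * cxx K * fst T + cxy K * snd T + cx K) * (fst Q - fst P)
    + (cxy K * fst T + 2 * cyy K * snd T + cy K) * (snd Q - snd P) = 0.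

(* A Poncelet chain P 0, P 1, P 2, ... for K1, K2.  Two consecutive links lie
   on different lines: from each vertex the chain leaves along the other
   tangent to K2 instead of running back along the link it arrived by. *)
Definition poncelet_chain (K1 K2 : conic) (P : nat -> point) : Prop :=
  forall i : nat,
    on_conic K1 (P i) /\
    touches (P i) (P (S i)) K2 /\
    ~ collinear (P i) (P (S i)) (P (S (S i))).

Definition closes_up (n : nat) (P : nat -> point) : Prop := P n = P 0%nat.

(* The periodic sequence X, Y, Z, X, Y, Z, ... *)
Fixpoint cycle3 (X Y Z : point) (i : nat) : point :=
  match i with
  | O => X
  | S j => cycle3 Y Z X j
  end.

Definition inscribed (P Q T : point) (K : conic) : Prop :=
  on_conic K P /\ on_conic K Q /\ on_conic K T.

Definition circumscribed (P Q T : point) (K : conic) : Prop :=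
  touches P Q K /\ touches Q T K /\ touches T P K.

(* The triangles inscribed in K1 and circumscribed around K2, each one being
   represented by its set of vertices, so that relabelling the vertices does
   not give another triangle. *)
Definition poncelet_triangles (K1 K2 : conic) : Ensemble (Ensemble point) :=
  fun V => exists P Q T : point,
    V = Triple point P Q T /\ ~ collinear P Q T /\
    inscribed P Q T K1 /\ circumscribed P Q T K2.

(* Main.v *)
Require Import Defs.
From Stdlib Require Import Lra Lia List FinFun.
From Stdlib Require Import Reals Ensembles Finite_sets.
Open Scope R_scope.

(* Let p, q, r be twice the cosines of the thirds of the angles.  In trilinear
   coordinates x : y : z of ABC the trisectors are y = p z, z = p y, z = q x,
   x = q z, x = r y, y = r x, and they touch the conic K2 with dual equation
   u^2 + v^2 + w^2 + (p + 1/p) v w + (q + 1/q) w u + (r + 1/r) u v = 0.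

   In coordinates with respect to the triangle X1 Y1 Z1, K2 has the dual equation
   A v w + B w u + C u v = 0 and K1 the equation a y z + b z x + c x y = 0, all
   coefficients being positive.  K1 is parametrized by (a Y Z : b Z X : c X Y) with
   X + Y + Z = 0, and the chord through two of its points touches K2 when
   a A Y Y' Z Z' + b B Z Z' X X' + c C X X' Y Y' = 0.  The signs of the coefficients
   make this, as an equation in (X' : Y' : Z'), have two distinct real solutions;
   multiplied by X Y' - X' Y, its left-hand side is f g' - f' g for two cubics f, g,
   which is the closure in three steps.

   All the points involved are at finite distance because K1 and K2 are ellipses.
   For K1 this follows from the fact that K1 misses the three side lines of ABC, of
   which the line at infinity is a positive combination; with n = pqr and
   k = cos (PI/3 - al), al a third of the angle A, the discriminant for the side BC
   has the sign of - (n - 1) (k^2 (n - 1) + 1). *)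

(** * Points, collinearity and symmetry of tangency *)

Lemma point_eq (P Q : point) : fst P = fst Q -> snd P = snd Q -> P = Q.
Proof. destruct P, Q; simpl; intros -> ->; reflexivity. Qed.

Lemma collinear_param (P Q T : point) :
  P <> Q -> collinear P Q T ->
  exists s : R, fst T = fst P + s * (fst Q - fst P) /\
                snd T = snd P + s * (snd Q - snd P).
Proof.
  unfold collinear; intros hPQ h.
  destruct (Req_dec (fst Q - fst P) 0) as [h1 | h1].
  - destruct (Req_dec (snd Q - snd P) 0) as [h2 | h2].
    + exfalso; apply hPQ, point_eq; lra.
    + exists ((snd T - snd P) / (snd Q - snd P)); split.
      * rewrite h1 in *.
        assert (fst T - fst P = 0); [| lra].
        apply (Rmult_eq_reg_l (snd Q - snd P)); lra.
      * field; exact h2.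
  - exists ((fst T - fst P) / (fst Q - fst P)); split.
    + field; exact h1.
    + apply (Rmult_eq_reg_l (fst Q - fst P)); [| exact h1].
      transitivity ((fst Q - fst P) * snd P
                    + (snd Q - snd P) * (fst T - fst P)); [lra | field; exact h1].
Qed.

Lemma collinear_swap12 (P Q T : point) : collinear P Q T -> collinear Q P T.
Proof. unfold collinear; intros h; ring_simplify; ring_simplify in h; lra. Qed.

Lemma collinear_rot (P Q T : point) : collinear P Q T -> collinear Q T P.
Proof. unfold collinear; intros h; ring_simplify; ring_simplify in h; lra. Qed.

Lemma collinear_diag (P Q : point) : collinear P P Q.
Proof. unfold collinear; ring. Qed.

Lemma collinear_right (P Q : point) : collinear P Q Q.
Proof. unfold collinear; ring. Qed.

Lemma collinear_ends (P Q : point) : collinear P Q P.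
Proof. unfold collinear; ring. Qed.

Lemma touches_sym (P Q : point) (K : conic) : touches P Q K -> touches Q P K.
Proof.
  intros [hPQ [T [hT [hK hg]]]]; split; [congruence |].
  exists T; split; [| split]; [| exact hK | lra].
  apply collinear_swap12, hT.
Qed.

(** * Porism for three-step chains *)

(** The last clause says that a chain at [P] has only the two continuations [Q] and [T]; it is what
    makes closure hold for every chain and not just for a suitably chosen one. *)
Definition porism3 (K1 K2 : conic) : Prop :=
  forall P : point, on_conic K1 P ->
  exists Q T : point,
    on_conic K1 Q /\ on_conic K1 T /\ ~ collinear P Q T /\
    touches P Q K2 /\ touches Q T K2 /\ touches T P K2 /\
    (forall S : point, on_conic K1 S -> touches P S K2 -> S = Q \/ S = T).

Lemma cycle3_chain (K1 K2 : conic) (P Q T : point) :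
  on_conic K1 P -> on_conic K1 Q -> on_conic K1 T -> ~ collinear P Q T ->
  touches P Q K2 -> touches Q T K2 -> touches T P K2 ->
  poncelet_chain K1 K2 (cycle3 P Q T).
Proof.
  intros h1 h2 h3 h4 h5 h6 h7 i.
  revert P Q T h1 h2 h3 h4 h5 h6 h7.
  induction i as [| i IH]; intros P Q T h1 h2 h3 h4 h5 h6 h7.
  - simpl; tauto.
  (* [cycle3 P Q T (S i)] is [cycle3 Q T P i], and the hypotheses are invariant under this
     rotation. *)
  - apply (IH Q T P); trivial.
    intros h; apply h4, collinear_rot, collinear_rot, h.
Qed.

(** Each vertex of the triangle through [P 0] has exactly two neighbours, and the non-collinearity
    clause of a chain forbids going back along the last link; so the chain must run around the
    triangle, in one of the two senses. *)
Lemma porism3_closes (K1 K2 : conic) (P : nat -> point) :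
  porism3 K1 K2 -> poncelet_chain K1 K2 P -> closes_up 3 P.
Proof.
  intros hpor hP; unfold closes_up.
  destruct (hP 0%nat) as [k0 [t0 c0]], (hP 1%nat) as [k1 [t1 c1]],
    (hP 2%nat) as [k2 [t2 _]], (hP 3%nat) as [k3 _].
  destruct (hpor _ k0) as [Q [T [kQ [kT [cT [tPQ [tQT [tTP huniq]]]]]]]].
  (* The porism at each of the two vertices following [P 0] identifies the
     neighbours of that vertex. *)
  assert (step : forall U V W S : point,
    on_conic K1 U -> on_conic K1 V -> on_conic K1 W -> on_conic K1 S ->
    V <> W -> touches U V K2 -> touches U W K2 -> touches U S K2 ->
    S = V \/ S = W).
  { intros U V W S kU kV kW kS hVW tV tW tS.
    destruct (hpor _ kU) as [V' [W' [_ [_ [_ [_ [_ [_ hu]]]]]]]].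
    destruct (hu _ kV tV), (hu _ kW tW), (hu _ kS tS); subst; tauto. }
  assert (hPQ : P 0%nat <> Q) by apply tPQ.
  assert (hQT : Q <> T) by apply tQT.
  assert (hTP : T <> P 0%nat) by apply tTP.
  assert (n02 : P 2%nat <> P 0%nat).
  { intros h; apply c0; rewrite h; apply collinear_ends. }
  assert (n13 : P 3%nat <> P 1%nat).
  { intros h; apply c1; rewrite h; apply collinear_ends. }
  destruct (huniq _ k1 t0) as [e1 | e1].
  - rewrite e1 in *.
    destruct (step Q (P 0%nat) T (P 2%nat)) as [e2 | e2]; trivial; try congruence.
    { apply touches_sym, tPQ. }
    rewrite e2 in *.
    destruct (step T (P 0%nat) Q (P 3%nat)) as [e3 | e3]; trivial; try congruence.
    apply touches_sym, tQT.
  - rewrite e1 in *.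
    destruct (step T (P 0%nat) Q (P 2%nat)) as [e2 | e2]; trivial; try congruence.
    { apply touches_sym, tQT. }
    rewrite e2 in *.
    destruct (step Q (P 0%nat) T (P 3%nat)) as [e3 | e3]; trivial; try congruence.
    apply touches_sym, tPQ.
Qed.

(** Passes from triangles to vertices, so that finiteness can be refuted by exhibiting infinitely
    many vertices. *)
Lemma finite_triples_listable (F : Ensemble (Ensemble point)) :
  Finite (Ensemble point) F ->
  (forall V, Ensembles.In _ F V -> exists P Q T : point, V = Triple point P Q T) ->
  exists l : list point, forall V P, Ensembles.In _ F V -> Ensembles.In _ V P -> List.In P l.
Proof.
  intros hF; induction hF as [| F hF IH V hV]; intros htri.
  - exists nil; intros V P [].
  - destruct IH as [l hl].
    { intros W hW; apply htri; left; exact hW. }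
    destruct (htri V) as [P [Q [T eV]]]; [right; constructor |].
    exists (P :: Q :: T :: l).
    intros W S hW hS; destruct hW as [W hW | W hW].
    + simpl; do 3 right; exact (hl W S hW hS).
    + destruct hW; rewrite eV in hS; destruct hS; simpl; tauto.
Qed.

Lemma injective_nat_not_listable (U : Type) (h : nat -> U) (l : list U) :
  (forall m n, h m = h n -> m = n) -> (forall n, List.In (h n) l) -> False.
Proof.
  intros hinj hl.
  assert (hnd : NoDup (map h (seq 0 (S (length l))))).
  { apply Injective_map_NoDup; [exact hinj | apply seq_NoDup]. }
  apply (NoDup_incl_length (l' := l)) in hnd.
  - rewrite length_map, length_seq in hnd; lia.
  - intros u hu; apply in_map_iff in hu; destruct hu as [n [<- _]]; apply hl.
Qed.

(** Every [h n] is a vertex of some Poncelet triangle, whereas finitely many triangles have only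
    finitely many vertices. *)
Lemma porism3_infinite (K1 K2 : conic) (h : nat -> point) :
  porism3 K1 K2 -> (forall m n, h m = h n -> m = n) ->
  (forall n, on_conic K1 (h n)) ->
  ~ Finite (Ensemble point) (poncelet_triangles K1 K2).
Proof.
  intros hpor hinj hK hfin.
  destruct (finite_triples_listable _ hfin) as [l hl].
  { intros V [P [Q [T [hV _]]]]; exists P, Q, T; exact hV. }
  apply (injective_nat_not_listable _ h l hinj); intros n.
  destruct (hpor _ (hK n)) as [Q [T [kQ [kT [cT [t1 [t2 [t3 _]]]]]]]].
  apply (hl (Triple point (h n) Q T)); [| constructor].
  exists (h n), Q, T; split; [reflexivity |].
  split; [exact cT |].
  exact (conj (conj (hK n) (conj kQ kT)) (conj t1 (conj t2 t3))).
Qed.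

(** * Affine changes of coordinates *)

Record affine_iso : Type := AffineIso {
  m11 : R; m12 : R; v1 : R; m21 : R; m22 : R; v2 : R;
  affine_iso_det : m11 * m22 - m12 * m21 <> 0
}.

Definition aff (f : affine_iso) (T : point) : point :=
  (m11 f * fst T + m12 f * snd T + v1 f, m21 f * fst T + m22 f * snd T + v2 f).

Definition aff_inv (f : affine_iso) (S : point) : point :=
  let D := m11 f * m22 f - m12 f * m21 f in
  ((m22 f * (fst S - v1 f) - m12 f * (snd S - v2 f)) / D,
   (m11 f * (snd S - v2 f) - m21 f * (fst S - v1 f)) / D).

Lemma aff_invK (f : affine_iso) (S : point) : aff f (aff_inv f S) = S.
Proof. apply point_eq; simpl; field; exact (affine_iso_det f). Qed.

Lemma aff_surj (f : affine_iso) (S : point) : exists T : point, aff f T = S.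
Proof. exists (aff_inv f S); apply aff_invK. Qed.

Lemma aff_inj (f : affine_iso) (P Q : point) : aff f P = aff f Q -> P = Q.
Proof.
  pose proof (affine_iso_det f) as hd.
  intros h; injection h; intros h2 h1.
  apply point_eq; apply (Rmult_eq_reg_l (m11 f * m22 f - m12 f * m21 f));
    trivial.
  - transitivity (m22 f * (m11 f * fst P + m12 f * snd P + v1 f)
      - m12 f * (m21 f * fst P + m22 f * snd P + v2 f)
      - m22 f * v1 f + m12 f * v2 f); [ring | rewrite h1, h2; ring].
  - transitivity (m11 f * (m21 f * fst P + m22 f * snd P + v2 f)
      - m21 f * (m11 f * fst P + m12 f * snd P + v1 f)
      - m11 f * v2 f + m21 f * v1 f); [ring | rewrite h1, h2; ring].
Qed.

Lemma collinear_aff (f : affine_iso) (P Q T : point) :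
  collinear (aff f P) (aff f Q) (aff f T) <-> collinear P Q T.
Proof.
  pose proof (affine_iso_det f) as hd.
  unfold collinear, aff; cbn [fst snd].
  set (D := m11 f * m22 f - m12 f * m21 f) in *.
  match goal with |- ?l = 0 <-> ?r = 0 =>
    assert (h : l = D * r) by (unfold D; ring) end.
  rewrite h; split; intros h'.
  - apply Rmult_integral in h'; tauto.
  - rewrite h'; ring.
Qed.

Definition pullback (f : affine_iso) (K : conic) : conic.
Proof.
  refine (Conic
    (cxx K * m11 f ^ 2 + cxy K * m11 f * m21 f + cyy K * m21 f ^ 2)
    (2 * cxx K * m11 f * m12 f + cxy K * (m11 f * m22 f + m12 f * m21 f)
       + 2 * cyy K * m21 f * m22 f)
    (cxx K * m12 f ^ 2 + cxy K * m12 f * m22 f + cyy K * m22 f ^ 2)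
    (2 * cxx K * m11 f * v1 f + cxy K * (m11 f * v2 f + v1 f * m21 f)
       + 2 * cyy K * m21 f * v2 f + cx K * m11 f + cy K * m21 f)
    (2 * cxx K * m12 f * v1 f + cxy K * (m12 f * v2 f + v1 f * m22 f)
       + 2 * cyy K * m22 f * v2 f + cx K * m12 f + cy K * m22 f)
    (cxx K * v1 f ^ 2 + cxy K * v1 f * v2 f + cyy K * v2 f ^ 2
       + cx K * v1 f + cy K * v2 f + c0 K) _).
  pose proof (affine_iso_det f) as hd; pose proof (conic_nondegenerate K) as hK.
  intros h.
  (* The substitution multiplies the determinant of the equation by the square of the determinant of
     [f]. *)
  apply (Rmult_integral_contrapositive_currified _ _
           (pow_nonzero _ 2 hd) hK).
  rewrite <- h; ring.
Defined.

Lemma on_conic_pullback (f : affine_iso) (K : conic) (T : point) :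
  on_conic (pullback f K) T <-> on_conic K (aff f T).
Proof.
  unfold on_conic, pullback, aff; simpl.
  match goal with |- ?l = 0 <-> ?r = 0 =>
    assert (h : l = r) by ring; rewrite h end; tauto.
Qed.

(** By the chain rule the derivative of the equation along [PQ] is the same before and after the
    substitution. *)
Lemma touches_pullback (f : affine_iso) (K : conic) (P Q : point) :
  touches P Q (pullback f K) <-> touches (aff f P) (aff f Q) K.
Proof.
  assert (hgrad : forall T,
    (2 * cxx (pullback f K) * fst T + cxy (pullback f K) * snd T
       + cx (pullback f K)) * (fst Q - fst P)
    + (cxy (pullback f K) * fst T + 2 * cyy (pullback f K) * snd T
       + cy (pullback f K)) * (snd Q - snd P)
    = (2 * cxx K * fst (aff f T) + cxy K * snd (aff f T) + cx K)
        * (fst (aff f Q) - fst (aff f P))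
      + (cxy K * fst (aff f T) + 2 * cyy K * snd (aff f T) + cy K)
        * (snd (aff f Q) - snd (aff f P))).
  { intros T; unfold pullback, aff; simpl; ring. }
  split; intros [hPQ [T [hl [hK hg]]]].
  - split; [intros h; exact (hPQ (aff_inj f _ _ h)) |].
    exists (aff f T); split; [| split].
    + apply collinear_aff, hl.
    + apply on_conic_pullback, hK.
    + rewrite <- hgrad; exact hg.
  - split; [congruence |].
    destruct (aff_surj f T) as [T' <-].
    exists T'; split; [| split].
    + apply (collinear_aff f), hl.
    + apply on_conic_pullback, hK.
    + rewrite hgrad; exact hg.
Qed.

Lemma porism3_pullback (f : affine_iso) (K1 K2 : conic) :
  porism3 K1 K2 -> porism3 (pullback f K1) (pullback f K2).
Proof.
  intros hpor P hP.
  apply on_conic_pullback in hP.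
  destruct (hpor _ hP) as [Q [T [kQ [kT [cT [t1 [t2 [t3 hu]]]]]]]].
  destruct (aff_surj f Q) as [Q' <-], (aff_surj f T) as [T' <-].
  exists Q', T'.
  split; [apply on_conic_pullback; exact kQ |].
  split; [apply on_conic_pullback; exact kT |].
  split; [intros h; apply cT, collinear_aff, h |].
  split; [apply touches_pullback; exact t1 |].
  split; [apply touches_pullback; exact t2 |].
  split; [apply touches_pullback; exact t3 |].
  intros S hS tS.
  apply on_conic_pullback in hS; apply touches_pullback in tS.
  destruct (hu _ hS tS) as [e | e]; apply aff_inj in e; tauto.
Qed.

(** * Tangents of ellipses *)

(** On the points [P + s (Q - P)] the equation of [K] becomes [al s^2 + be s + ga], and tangency is
    a double root. The ellipse condition ensures that the double root is a finite point. *)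
Lemma touches_iff_discriminant (K : conic) (P Q : point) :
  cxy K ^ 2 < 4 * cxx K * cyy K ->
  let d1 := fst Q - fst P in
  let d2 := snd Q - snd P in
  touches P Q K <->
  P <> Q /\
  ((2 * cxx K * fst P + cxy K * snd P + cx K) * d1
     + (cxy K * fst P + 2 * cyy K * snd P + cy K) * d2) ^ 2
  - 4 * (cxx K * d1 ^ 2 + cxy K * d1 * d2 + cyy K * d2 ^ 2)
    * (cxx K * fst P ^ 2 + cxy K * fst P * snd P + cyy K * snd P ^ 2
       + cx K * fst P + cy K * snd P + c0 K) = 0.
Proof.
  intros hell d1 d2.
  set (al := cxx K * d1 ^ 2 + cxy K * d1 * d2 + cyy K * d2 ^ 2).
  set (be := (2 * cxx K * fst P + cxy K * snd P + cx K) * d1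
     + (cxy K * fst P + 2 * cyy K * snd P + cy K) * d2).
  set (ga := cxx K * fst P ^ 2 + cxy K * fst P * snd P + cyy K * snd P ^ 2
       + cx K * fst P + cy K * snd P + c0 K).
  split; intros [hPQ h]; split; trivial.
  - destruct h as [T [hl [hK hg]]].
    destruct (collinear_param P Q T hPQ hl) as [s [e1 e2]].
    fold d1 in e1; fold d2 in e2; fold d1 d2 in hg.
    unfold on_conic in hK.
    assert (h1 : al * s ^ 2 + be * s + ga = 0).
    { rewrite <- hK, e1, e2; unfold al, be, ga; ring. }
    assert (h2 : 2 * al * s + be = 0).
    { rewrite <- hg, e1, e2; unfold al, be; ring. }
    replace (be ^ 2 - 4 * al * ga)
      with ((2 * al * s + be) ^ 2 - 4 * al * (al * s ^ 2 + be * s + ga)) by ring.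
    rewrite h1, h2; ring.
  (* Completing the square shows that the quadratic part of an ellipse is definite, so [al] vanishes
     only when [P = Q]. *)
  - assert (hal : al <> 0).
    { intros h0; apply hPQ.
      assert (hs : (4 * cxx K * cyy K - cxy K ^ 2) * d2 ^ 2
                   + (2 * cxx K * d1 + cxy K * d2) ^ 2 = 0).
      { transitivity (4 * cxx K * al); [unfold al; ring | rewrite h0; ring]. }
      pose proof (pow2_ge_0 d2); pose proof (pow2_ge_0 (cxy K)).
      pose proof (pow2_ge_0 (2 * cxx K * d1 + cxy K * d2)).
      assert (hc : cxx K <> 0) by (intros hc; rewrite hc in hell; lra).
      assert (h2 : d2 = 0).
      { destruct (Req_dec d2 0) as [h2 | h2]; trivial.
        assert (0 < d2 ^ 2) by nra; nra. }
      assert (h1 : d1 = 0).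
      { rewrite h2 in hs.
        assert (hz : 2 * cxx K * d1 = 0) by nra.
        apply (Rmult_eq_reg_l (2 * cxx K)); lra. }
      apply point_eq; unfold d1, d2 in *; lra. }
    (* The point of contact is given by the double root; only its defining equation is kept. *)
    destruct (exist (fun s => s = - be / (2 * al)) _ eq_refl) as [s hs].
    exists (fst P + s * d1, snd P + s * d2).
    split; [| split].
    + unfold line, collinear; simpl; fold d1 d2; ring.
    + unfold on_conic; cbn [fst snd].
      transitivity (al * s ^ 2 + be * s + ga); [unfold ga, be, al; ring |].
      transitivity (- (be ^ 2 - 4 * al * ga) / (4 * al));
        [rewrite hs; field; exact hal | rewrite h; field; exact hal].
    + fold d1 d2; cbn [fst snd].
      transitivity (2 * al * s + be); [unfold be, al; ring |].
      rewrite hs; field; exact hal.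
Qed.

(** * Conics around and in the triangle (1,0), (0,1), (0,0) *)

Definition third (T : point) : R := 1 - fst T - snd T.

(* In barycentric coordinates: a y z + b z x + c x y = 0. *)
Definition circumconic (a b c : R) (h : a * b * c <> 0) : conic.
Proof.
  refine (Conic (- b) (c - a - b) (- a) b a 0 _).
  intros h'; apply h; rewrite <- h'; ring.
Defined.

(* In barycentric coordinates its dual is A v w + B w u + C u v = 0. *)
Definition inconic (A B C : R) (h : A * B * C <> 0) : conic.
Proof.
  refine (Conic ((A + C) ^ 2) (2 * (C * C - A * B + B * C + C * A))
    ((B + C) ^ 2) (- 2 * C * (A + C)) (- 2 * C * (B + C)) (C ^ 2) _).
  intros h'.
  assert (h2 : - 16 * (A * B * C) ^ 2 = 0) by (rewrite <- h'; ring).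
  apply (pow_nonzero _ 2 h); lra.
Defined.

Lemma on_circumconic (a b c : R) h (T : point) :
  on_conic (circumconic a b c h) T <->
  a * snd T * third T + b * third T * fst T + c * fst T * snd T = 0.
Proof.
  unfold on_conic, circumconic, third; simpl.
  match goal with |- ?l = 0 <-> ?r = 0 =>
    assert (e : l = r) by ring; rewrite e end; tauto.
Qed.

(** [u : v : w] are the line coordinates of [PQ], and the discriminant is [-16 A B C] times the dual
    form at them. Positive [A], [B], [C] make the inconic an ellipse. *)
Lemma touches_inconic (A B C : R) h (P Q : point) :
  0 < A -> 0 < B -> 0 < C ->
  let u := snd P * third Q - third P * snd Q in
  let v := third P * fst Q - fst P * third Q in
  let w := fst P * snd Q - snd P * fst Q in
  touches P Q (inconic A B C h) <->
  P <> Q /\ A * v * w + B * w * u + C * u * v = 0.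
Proof.
  intros hA hB hC u v w.
  rewrite touches_iff_discriminant.
  - match goal with |- _ /\ ?l = 0 <-> _ /\ ?r = 0 =>
      assert (e : l = - 16 * (A * B * C) * r)
        by (unfold u, v, w, third, inconic; simpl; ring); rewrite e end.
    split; intros [h1 h2]; split; trivial.
    + apply Rmult_integral in h2; destruct h2 as [h2 | h2]; trivial.
      exfalso; apply h; lra.
    + rewrite h2; ring.
  - simpl.
    assert (0 < A * B * C * (A + B + C)).
    { repeat apply Rmult_lt_0_compat; lra. }
    apply Rlt_0_minus.
    match goal with |- 0 < ?l =>
      replace l with (16 * (A * B * C * (A + B + C))) by ring end.
    lra.
Qed.

(** Line coordinates are unique up to a factor, so any non-zero triple vanishing at [P] and [Q] may
    replace the minors of [touches_inconic]. The factor is cancelled through whichever of [u], [v],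
    [w] is non-zero. *)
Lemma touches_inconic_of_line (A B C : R) h (P Q : point) (u v w : R) :
  0 < A -> 0 < B -> 0 < C ->
  P <> Q -> ~ (u = 0 /\ v = 0 /\ w = 0) ->
  A * v * w + B * w * u + C * u * v = 0 ->
  u * fst P + v * snd P + w * third P = 0 ->
  u * fst Q + v * snd Q + w * third Q = 0 ->
  touches P Q (inconic A B C h).
Proof.
  intros hA hB hC hPQ hne hd hP hQ.
  apply touches_inconic; trivial; split; trivial.
  set (x1 := fst P) in *; set (y1 := snd P) in *; set (z1 := third P) in *.
  set (x2 := fst Q) in *; set (y2 := snd Q) in *; set (z2 := third Q) in *.
  set (u' := y1 * z2 - z1 * y2); set (v' := z1 * x2 - x1 * z2).
  set (w' := x1 * y2 - y1 * x2).
  assert (e1 : u * v' = v * u').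
  { apply Rminus_diag_uniq.
    transitivity (z1 * (u * x2 + v * y2 + w * z2)
                  - z2 * (u * x1 + v * y1 + w * z1));
      [unfold u', v'; ring | rewrite hP, hQ; ring]. }
  assert (e2 : v * w' = w * v').
  { apply Rminus_diag_uniq.
    transitivity (x1 * (u * x2 + v * y2 + w * z2)
                  - x2 * (u * x1 + v * y1 + w * z1));
      [unfold w', v'; ring | rewrite hP, hQ; ring]. }
  assert (e3 : w * u' = u * w').
  { apply Rminus_diag_uniq.
    transitivity (y1 * (u * x2 + v * y2 + w * z2)
                  - y2 * (u * x1 + v * y1 + w * z1));
      [unfold u', w'; ring | rewrite hP, hQ; ring]. }
  set (F := A * v' * w' + B * w' * u' + C * u' * v').
  assert (cancel : forall k, k <> 0 -> k * k * F = 0 -> F = 0).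
  { intros k hk hF; apply (Rmult_eq_reg_l (k * k)); [lra | nra]. }
  destruct (Req_dec u 0) as [hu | hu]; [destruct (Req_dec v 0) as [hv | hv];
    [destruct (Req_dec w 0) as [hw | hw] |] |].
  - tauto.
  - apply (cancel w hw).
    transitivity (A * (w * v') * (w * w') + B * (w * w') * (w * u')
                  + C * (w * u') * (w * v')); [unfold F; ring |].
    rewrite e3, <- e2.
    transitivity (w' * w' * (A * v * w + B * w * u + C * u * v));
      [ring | rewrite hd; ring].
  - apply (cancel v hv).
    transitivity (A * (v * v') * (v * w') + B * (v * w') * (v * u')
                  + C * (v * u') * (v * v')); [unfold F; ring |].
    rewrite e2, <- e1.
    transitivity (v' * v' * (A * v * w + B * w * u + C * u * v));
      [ring | rewrite hd; ring].
  - apply (cancel u hu).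
    transitivity (A * (u * v') * (u * w') + B * (u * w') * (u * u')
                  + C * (u * u') * (u * v')); [unfold F; ring |].
    rewrite e1, <- e3.
    transitivity (u' * u' * (A * v * w + B * w * u + C * u * v));
      [ring | rewrite hd; ring].
Qed.

(** * Rational parametrization of the circumconic *)

(* The points of the circumconic are (a Y Z : b Z X : c X Y) with
   (X : Y : Z) on the line X + Y + Z = 0. *)
Definition has_param (a b c : R) (T : point) (X Y : R) : Prop :=
  exists k : R, k <> 0 /\
    fst T = - (k * (a * Y * (X + Y))) /\
    snd T = - (k * (b * X * (X + Y))) /\
    third T = k * (c * X * Y).

(* The value of x + y + z at (a Y Z : b Z X : c X Y): when it is definite, the
   circumconic does not meet the line at infinity. *)
Definition infinity_form (a b c X Y : R) : R :=
  c * X * Y - (a * Y + b * X) * (X + Y).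

Lemma param_exists (a b c : R) h (T : point) :
  on_conic (circumconic a b c h) T ->
  exists X Y : R, (X <> 0 \/ Y <> 0) /\ has_param a b c T X Y.
Proof.
  intros hT; apply on_circumconic in hT.
  assert (ha : a <> 0) by (intros e; apply h; rewrite e; ring).
  assert (hb : b <> 0) by (intros e; apply h; rewrite e; ring).
  assert (hc : c <> 0) by (intros e; apply h; rewrite e; ring).
  unfold has_param.
  set (x := fst T) in *; set (y := snd T) in *.
  assert (hs : x + y + third T = 1) by (unfold third, x, y; ring).
  set (z := third T) in *.
  destruct (Req_dec x 0) as [hx | hx]; [| destruct (Req_dec y 0) as [hy | hy];
    [| destruct (Req_dec z 0) as [hz | hz]]].
  - assert (hyz : y * z = 0).
    { apply (Rmult_eq_reg_l a); trivial; rewrite hx in hT; lra. }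
    apply Rmult_integral in hyz; destruct hyz as [e | e].
    + exists 1, (-1); split; [lra |].
      exists (- / c); split; [apply Ropp_neq_0_compat, Rinv_neq_0_compat, hc |].
      repeat split; [lra | lra |].
      replace z with 1 by lra; field; exact hc.
    + exists 1, 0; split; [lra |].
      exists (- / b); split; [apply Ropp_neq_0_compat, Rinv_neq_0_compat, hb |].
      repeat split; [lra | | lra].
      replace y with 1 by lra; field; exact hb.
  - assert (hzx : z * x = 0).
    { apply (Rmult_eq_reg_l b); trivial; rewrite hy in hT; lra. }
    apply Rmult_integral in hzx; destruct hzx as [e | e]; [| lra].
    exists 0, 1; split; [lra |].
    exists (- / a); split; [apply Ropp_neq_0_compat, Rinv_neq_0_compat, ha |].
    repeat split; [| lra | lra].
    replace x with 1 by lra; field; exact ha.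
  - exfalso; rewrite hz in hT.
    assert (e : c * (x * y) = 0) by lra.
    apply Rmult_integral in e; destruct e as [e | e]; [contradiction |].
    apply Rmult_integral in e; tauto.
  - exists (a * y * z), (b * z * x); split.
    { left; repeat apply Rmult_integral_contrapositive_currified; assumption. }
    assert (hZ : a * y * z + b * z * x = - (c * x * y)) by lra.
    exists (/ (a * b * c * x * y * z)).
    split; [| rewrite hZ; repeat split; field; tauto].
    apply Rinv_neq_0_compat.
    repeat apply Rmult_integral_contrapositive_currified; assumption.
Qed.

(** Division by [infinity_form] normalizes the barycentric coordinates to sum 1. *)
Definition param_point (a b c X Y : R) : point :=
  let w := infinity_form a b c X Y in
  (- (/ w * (a * Y * (X + Y))), - (/ w * (b * X * (X + Y)))).

Lemma param_pointP (a b c : R) h (X Y : R) :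
  infinity_form a b c X Y <> 0 ->
  on_conic (circumconic a b c h) (param_point a b c X Y) /\
  has_param a b c (param_point a b c X Y) X Y.
Proof.
  unfold param_point; intros hw.
  set (w := infinity_form a b c X Y) in *.
  set (T := (- (/ w * (a * Y * (X + Y))), - (/ w * (b * X * (X + Y))))).
  assert (h3 : third T = / w * (c * X * Y)).
  { apply (Rmult_eq_reg_l w); trivial.
    transitivity (w + (a * Y + b * X) * (X + Y));
      [unfold third, T; simpl; field; exact hw |].
    rewrite <- Rmult_assoc, Rinv_r, Rmult_1_l by exact hw.
    unfold w, infinity_form; ring. }
  split.
  - apply on_circumconic; rewrite h3; unfold T; simpl; ring.
  - exists (/ w); split; [apply Rinv_neq_0_compat, hw | simpl; tauto].
Qed.

(** Vanishes exactly when two non-zero parameter pairs are the same point of the projective line. *)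
Definition cross (X1 Y1 X2 Y2 : R) : R := X1 * Y2 - X2 * Y1.

(** Proportional barycentric triples that both sum to 1 are equal. *)
Lemma point_eq_of_cross (P Q : point) :
  snd P * third Q - third P * snd Q = 0 ->
  third P * fst Q - fst P * third Q = 0 ->
  fst P * snd Q - snd P * fst Q = 0 -> P = Q.
Proof.
  intros h1 h2 h3.
  assert (hP : fst P + snd P + third P = 1) by (unfold third; ring).
  assert (hQ : fst Q + snd Q + third Q = 1) by (unfold third; ring).
  apply point_eq; apply Rminus_diag_uniq.
  - transitivity (fst P * (fst Q + snd Q + third Q)
                  - fst Q * (fst P + snd P + third P));
      [rewrite hP, hQ; ring | lra].
  - transitivity (snd P * (fst Q + snd Q + third Q)
                  - snd Q * (fst P + snd P + third P));
      [rewrite hP, hQ; ring | lra].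
Qed.

Lemma param_inj (a b c : R) (P Q : point) (X1 Y1 X2 Y2 : R) :
  has_param a b c P X1 Y1 -> has_param a b c Q X2 Y2 ->
  cross X1 Y1 X2 Y2 = 0 -> P = Q.
Proof.
  intros [k [_ [p1 [p2 p3]]]] [l [_ [q1 [q2 q3]]]] h.
  apply point_eq_of_cross; rewrite ?p1, ?p2, ?p3, ?q1, ?q2, ?q3.
  - transitivity (- k * l * b * c * X1 * X2 * cross X1 Y1 X2 Y2);
      [unfold cross; ring | rewrite h; ring].
  - transitivity (- k * l * a * c * Y1 * Y2 * cross X1 Y1 X2 Y2);
      [unfold cross; ring | rewrite h; ring].
  - transitivity (- k * l * a * b * (X1 + Y1) * (X2 + Y2) * cross X1 Y1 X2 Y2);
      [unfold cross; ring | rewrite h; ring].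
Qed.

(** * Chords of the circumconic that touch the inconic *)

(* The chord joining the points with parameters (X1 : Y1) and (X2 : Y2)
   touches the inconic when this form vanishes. *)
Definition chord_form (al be ka X1 Y1 X2 Y2 : R) : R :=
  al * (Y1 * Y2) * ((X1 + Y1) * (X2 + Y2))
  + be * ((X1 + Y1) * (X2 + Y2)) * (X1 * X2)
  + ka * (X1 * X2) * (Y1 * Y2).

(** All line coordinates of the chord contain the factor [k l cross], non-zero for distinct points;
    once it is removed, the dual form is [a b c] times the chord form. *)
Lemma touches_chord (a b c : R) (h : a * b * c <> 0) (A B C : R) h'
    (P Q : point) (X1 Y1 X2 Y2 : R) :
  0 < A -> 0 < B -> 0 < C ->
  has_param a b c P X1 Y1 -> has_param a b c Q X2 Y2 -> P <> Q ->
  (touches P Q (inconic A B C h') <->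
   chord_form (a * A) (b * B) (c * C) X1 Y1 X2 Y2 = 0).
Proof.
  intros hA hB hC hP hQ hPQ.
  assert (hx : cross X1 Y1 X2 Y2 <> 0).
  { intros e; apply hPQ; exact (param_inj _ _ _ _ _ _ _ _ _ hP hQ e). }
  destruct hP as [k [hk [p1 [p2 p3]]]], hQ as [l [hl [q1 [q2 q3]]]].
  rewrite touches_inconic by assumption.
  match goal with |- _ /\ ?e = 0 <-> ?g = 0 =>
    assert (e1 : e = (k * l * cross X1 Y1 X2 Y2) ^ 2 * (a * b * c) * g) end.
  { rewrite p1, p2, p3, q1, q2, q3; unfold cross, chord_form; ring. }
  rewrite e1; split.
  - intros [_ e].
    apply Rmult_integral in e; destruct e as [e | e]; trivial; exfalso.
    apply Rmult_integral in e; destruct e as [e | e]; [| tauto].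
    revert e; apply pow_nonzero.
    repeat apply Rmult_integral_contrapositive_currified; assumption.
  - intros e; split; [exact hPQ | rewrite e; ring].
Qed.

Lemma collinear_det (P Q T : point) :
  collinear P Q T <->
    fst P * (snd Q * third T - third Q * snd T)
    + snd P * (third Q * fst T - fst Q * third T)
    + third P * (fst Q * snd T - snd Q * fst T) = 0.
Proof.
  unfold collinear.
  match goal with |- ?l = 0 <-> ?r = 0 =>
    assert (e' : l = r) by (unfold third; ring); rewrite e' end; tauto.
Qed.

(** The barycentric determinant of three points of the conic factors, like a Vandermonde
    determinant, into the three crosses. *)
Lemma param_not_collinear (a b c : R) (h : a * b * c <> 0)
    (P Q T : point) (X1 Y1 X2 Y2 X3 Y3 : R) :
  has_param a b c P X1 Y1 -> has_param a b c Q X2 Y2 ->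
  has_param a b c T X3 Y3 ->
  cross X1 Y1 X2 Y2 <> 0 -> cross X2 Y2 X3 Y3 <> 0 -> cross X3 Y3 X1 Y1 <> 0 ->
  ~ collinear P Q T.
Proof.
  intros [k [hk [p1 [p2 p3]]]] [l [hl [q1 [q2 q3]]]] [m [hm [t1 [t2 t3]]]]
    h12 h23 h31 e.
  apply collinear_det in e.
  rewrite p1, p2, p3, q1, q2, q3, t1, t2, t3 in e.
  apply (Rmult_integral_contrapositive_currified (k * l * m * (a * b * c))
           (cross X1 Y1 X2 Y2 * cross X2 Y2 X3 Y3 * cross X3 Y3 X1 Y1)).
  - apply Rmult_integral_contrapositive_currified; [| exact h].
    repeat apply Rmult_integral_contrapositive_currified; assumption.
  - repeat apply Rmult_integral_contrapositive_currified; assumption.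
  - apply Ropp_eq_compat in e; rewrite Ropp_0 in e; rewrite <- e;
      unfold cross; ring.
Qed.

Lemma cross_eq0 (X1 Y1 X2 Y2 : R) :
  X1 <> 0 \/ Y1 <> 0 -> cross X1 Y1 X2 Y2 = 0 ->
  exists k : R, X2 = k * X1 /\ Y2 = k * Y1.
Proof.
  unfold cross; intros [h | h] e.
  - exists (X2 / X1); split; [field; exact h |].
    apply (Rmult_eq_reg_l X1); [| exact h].
    transitivity (X2 * Y1); [lra | field; exact h].
  - exists (Y2 / Y1); split; [| field; exact h].
    apply (Rmult_eq_reg_l Y1); [| exact h].
    transitivity (X1 * Y2); [lra | field; exact h].
Qed.

Lemma binary_form_roots (g0 g1 g2 : R) :
  0 < g1 ^ 2 - 4 * g0 * g2 ->
  exists X2 Y2 X3 Y3 : R,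
    g0 * X2 ^ 2 + g1 * X2 * Y2 + g2 * Y2 ^ 2 = 0 /\
    g0 * X3 ^ 2 + g1 * X3 * Y3 + g2 * Y3 ^ 2 = 0 /\
    cross X2 Y2 X3 Y3 <> 0.
Proof.
  intros hD; destruct (Req_dec g0 0) as [h0 | h0].
  (* When [g0 = 0] the projective roots are [1 : 0] and [- g2 : g1]. *)
  - assert (h1 : g1 <> 0) by (intros e; rewrite h0, e in hD; lra).
    exists 1, 0, (- g2), g1; unfold cross; rewrite h0.
    split; [ring |]; split; [ring |]; lra.
  - set (s := sqrt (g1 ^ 2 - 4 * g0 * g2)).
    assert (hs : s * s = g1 ^ 2 - 4 * g0 * g2) by (apply sqrt_sqrt; lra).
    assert (hs0 : 0 < s) by (apply sqrt_lt_R0, hD).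
    exists (- g1 + s), (2 * g0), (- g1 - s), (2 * g0).
    split; [| split].
    + transitivity (g0 * (s * s - (g1 ^ 2 - 4 * g0 * g2)));
        [ring | rewrite hs; ring].
    + transitivity (g0 * (s * s - (g1 ^ 2 - 4 * g0 * g2)));
        [ring | rewrite hs; ring].
    + unfold cross.
      replace ((- g1 + s) * (2 * g0) - (- g1 - s) * (2 * g0))
        with (4 * (g0 * s)) by ring.
      assert (g0 * s <> 0); [| lra].
      apply Rmult_integral_contrapositive_currified; lra.
Qed.

Lemma chord_form_sym (al be ka X1 Y1 X2 Y2 : R) :
  chord_form al be ka X1 Y1 X2 Y2 = chord_form al be ka X2 Y2 X1 Y1.
Proof. unfold chord_form; ring. Qed.

(** On the diagonal the form is a positive combination of the squares of [Y (X + Y)], [(X + Y) X]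
    and [X Y], which vanish together only at the origin. *)
Lemma chord_form_diag (al be ka X Y : R) :
  0 < al -> 0 < be -> 0 < ka -> X <> 0 \/ Y <> 0 ->
  chord_form al be ka X Y X Y <> 0.
Proof.
  intros hal hbe hka hXY e.
  set (U := Y * (X + Y)); set (V := (X + Y) * X); set (W := X * Y).
  assert (e' : al * U ^ 2 + be * V ^ 2 + ka * W ^ 2 = 0).
  { rewrite <- e; unfold chord_form, U, V, W; ring. }
  pose proof (Rmult_le_pos _ _ (Rlt_le _ _ hal) (pow2_ge_0 U)).
  pose proof (Rmult_le_pos _ _ (Rlt_le _ _ hbe) (pow2_ge_0 V)).
  pose proof (Rmult_le_pos _ _ (Rlt_le _ _ hka) (pow2_ge_0 W)).
  assert (zero : forall k T, 0 < k -> k * T ^ 2 = 0 -> T = 0).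
  { intros k T hk hT; apply Rmult_integral in hT; destruct hT; [lra | nra]. }
  assert (hU : U = 0) by (apply (zero al); lra).
  assert (hV : V = 0) by (apply (zero be); lra).
  assert (hW : W = 0) by (apply (zero ka); lra).
  unfold U, V, W in *; apply Rmult_integral in hW; destruct hW as [h | h];
    rewrite h in *; nra.
Qed.

Lemma chord_form_scale (al be ka X1 Y1 k X Y : R) :
  chord_form al be ka X1 Y1 (k * X) (k * Y)
  = k ^ 2 * chord_form al be ka X1 Y1 X Y.
Proof. unfold chord_form; ring. Qed.

(* Up to the factor [cross], the chord form is f g' - f' g for two binary
   cubics f and g, so that the triples of parameters of the Poncelet triangles
   are the zeros of the members of a pencil of cubics. *)
Lemma chord_form_pencil (al be ka : R) :
  exists f g : R -> R -> R, forall X1 Y1 X2 Y2 : R,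
    cross X1 Y1 X2 Y2 * chord_form al be ka X1 Y1 X2 Y2
    = f X2 Y2 * g X1 Y1 - f X1 Y1 * g X2 Y2.
Proof.
  exists (fun X Y => X * Y * (X + Y)), (fun X Y =>
    ka * X ^ 2 * Y + be * X * (X + Y) ^ 2 - al * Y ^ 2 * (X + Y)).
  intros; unfold cross, chord_form; ring.
Qed.

(** By the pencil identity, the pairs [(f, g)] at the second and the third parameter are both
    proportional to the pair at the first. They are therefore proportional to each other, and
    [cross] can be cancelled. *)
Lemma chord_form_closes (al be ka X1 Y1 X2 Y2 X3 Y3 : R) :
  chord_form al be ka X1 Y1 X1 Y1 <> 0 ->
  cross X2 Y2 X3 Y3 <> 0 ->
  chord_form al be ka X1 Y1 X2 Y2 = 0 -> chord_form al be ka X1 Y1 X3 Y3 = 0 ->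
  chord_form al be ka X2 Y2 X3 Y3 = 0.
Proof.
  intros h11 h23 e2 e3.
  destruct (chord_form_pencil al be ka) as [f [g p]].
  pose proof (p X1 Y1 X2 Y2) as p12; pose proof (p X1 Y1 X3 Y3) as p13.
  rewrite e2 in p12; rewrite e3 in p13.
  assert (hfg : f X1 Y1 <> 0 \/ g X1 Y1 <> 0).
  { destruct (Req_dec (f X1 Y1) 0) as [hf | hf]; [| tauto].
    destruct (Req_dec (g X1 Y1) 0) as [hg | hg]; [| tauto].
    exfalso.
    assert (hz : forall X Y, cross X1 Y1 X Y * chord_form al be ka X1 Y1 X Y = 0).
    { intros X Y; rewrite p, hf, hg; ring. }
    (* A binary quadratic form that vanishes off one direction vanishes
       identically. *)
    apply h11.
    pose proof (hz (- Y1) X1) as z1; pose proof (hz (X1 - Y1) (Y1 + X1)) as z2.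
    pose proof (hz (- X1 - Y1) (- Y1 + X1)) as z3.
    assert (hn : X1 ^ 2 + Y1 ^ 2 <> 0).
    { intros h0; apply h11.
      assert (X1 = 0) by nra; assert (Y1 = 0) by nra; subst X1 Y1.
      unfold chord_form; ring. }
    apply (Rmult_eq_reg_l (2 * (X1 ^ 2 + Y1 ^ 2))); [| lra].
    (* Parallelogram law for the quadratic form at [v = (X1, Y1)] and [w = (- Y1, X1)]: the test
       points are [w], [w + v], [w - v], and each has cross [X1^2 + Y1^2] with [v]. *)
    transitivity
      (cross X1 Y1 (X1 - Y1) (Y1 + X1)
         * chord_form al be ka X1 Y1 (X1 - Y1) (Y1 + X1)
       + cross X1 Y1 (- X1 - Y1) (- Y1 + X1)
         * chord_form al be ka X1 Y1 (- X1 - Y1) (- Y1 + X1)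
       - 2 * (cross X1 Y1 (- Y1) X1 * chord_form al be ka X1 Y1 (- Y1) X1));
      [unfold cross, chord_form; ring | rewrite z1, z2, z3; ring]. }
  apply (Rmult_eq_reg_l (cross X2 Y2 X3 Y3)); [| exact h23].
  rewrite Rmult_0_r, p.
  destruct hfg as [h | h].
  - apply (Rmult_eq_reg_l (f X1 Y1)); [| exact h].
    transitivity (f X3 Y3 * (f X1 Y1 * g X2 Y2) - f X2 Y2 * (f X1 Y1 * g X3 Y3));
      [ring |].
    replace (f X1 Y1 * g X2 Y2) with (f X2 Y2 * g X1 Y1) by lra.
    replace (f X1 Y1 * g X3 Y3) with (f X3 Y3 * g X1 Y1) by lra.
    ring.
  - apply (Rmult_eq_reg_l (g X1 Y1)); [| exact h].
    transitivity (g X2 Y2 * (f X3 Y3 * g X1 Y1) - g X3 Y3 * (f X2 Y2 * g X1 Y1));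
      [ring |].
    replace (f X2 Y2 * g X1 Y1) with (f X1 Y1 * g X2 Y2) by lra.
    replace (f X3 Y3 * g X1 Y1) with (f X1 Y1 * g X3 Y3) by lra.
    ring.
Qed.

(** In the basis formed by its two known zeros a binary quadratic form reduces to its mixed term
    [H], and [H] is non-zero because the form is not identically zero. *)
Lemma chord_form_zeros (al be ka X1 Y1 X2 Y2 X3 Y3 X Y : R) :
  chord_form al be ka X1 Y1 X1 Y1 <> 0 ->
  cross X2 Y2 X3 Y3 <> 0 ->
  chord_form al be ka X1 Y1 X2 Y2 = 0 -> chord_form al be ka X1 Y1 X3 Y3 = 0 ->
  chord_form al be ka X1 Y1 X Y = 0 ->
  cross X2 Y2 X Y = 0 \/ cross X3 Y3 X Y = 0.
Proof.
  intros h11 h23 e2 e3 e.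
  set (F := chord_form al be ka X1 Y1) in *.
  set (d := cross X2 Y2 X3 Y3) in *.
  set (H := F (X2 + X3) (Y2 + Y3) - F X2 Y2 - F X3 Y3).
  assert (expand : forall X Y, d ^ 2 * F X Y
    = cross X3 Y3 X Y ^ 2 * F X2 Y2 + cross X2 Y2 X Y ^ 2 * F X3 Y3
      - cross X3 Y3 X Y * cross X2 Y2 X Y * H).
  { intros X' Y'; unfold H, F, d, cross, chord_form; ring. }
  assert (hH : H <> 0).
  { intros h0; apply h11; specialize (expand X1 Y1).
    rewrite e2, e3, h0 in expand.
    apply (Rmult_eq_reg_l (d ^ 2)); [lra | apply pow_nonzero, h23]. }
  specialize (expand X Y); rewrite e2, e3, e in expand.
  assert (e0 : cross X3 Y3 X Y * cross X2 Y2 X Y * H = 0) by lra.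
  apply Rmult_integral in e0; destruct e0 as [e0 | e0]; [| contradiction].
  apply Rmult_integral in e0; tauto.
Qed.

(** [U + V + W] is negative, so one of the three is. The discriminant can be written as a square
    plus a term having the sign opposite to any chosen one of them, because for instance
    [V W = X1^2 U]. *)
Lemma chord_form_roots (al be ka X1 Y1 : R) :
  0 < al -> 0 < be -> 0 < ka -> X1 <> 0 \/ Y1 <> 0 ->
  exists X2 Y2 X3 Y3 : R,
    chord_form al be ka X1 Y1 X2 Y2 = 0 /\
    chord_form al be ka X1 Y1 X3 Y3 = 0 /\
    cross X2 Y2 X3 Y3 <> 0.
Proof.
  intros hal hbe hka hXY.
  set (Z1 := - (X1 + Y1)).
  set (U := Y1 * Z1); set (V := Z1 * X1); set (W := X1 * Y1).
  (* The coefficients of the chord form in [X2], [Y2], with [- (X2 + Y2)] as the third parameter. *)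
  destruct (binary_form_roots (- be * V) (ka * W - al * U - be * V) (- al * U))
    as [X2 [Y2 [X3 [Y3 [e2 [e3 h]]]]]].
  - assert (hsum : U < 0 \/ V < 0 \/ W < 0).
    { destruct (Rlt_dec U 0); [tauto |]; destruct (Rlt_dec V 0); [tauto |].
      destruct (Rlt_dec W 0); [tauto | exfalso].
      assert (hq : U + V + W
        = - ((X1 + Y1) ^ 2 + X1 ^ 2 + Y1 ^ 2) / 2) by (unfold U, V, W, Z1; field).
      pose proof (pow2_ge_0 (X1 + Y1)).
      pose proof (pow2_ge_0 X1); pose proof (pow2_ge_0 Y1).
      destruct hXY as [h | h]; apply (pow_nonzero _ 2) in h; lra. }
    assert (pos : forall k T, 0 < k -> T <> 0 -> 0 < k * T ^ 2).
    { intros k T hk hT; apply Rmult_lt_0_compat; trivial.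
      pose proof (pow2_ge_0 T); pose proof (pow_nonzero _ 2 hT); lra. }
    destruct hsum as [hn | [hn | hn]].
    + replace ((ka * W - al * U - be * V) ^ 2 - 4 * (- be * V) * (- al * U))
        with ((al * U - be * V - ka * W) ^ 2 + 4 * (be * ka) * X1 ^ 2 * - U)
        by (unfold U, V, W; ring).
      assert (0 < 4 * (be * ka) * - U) by (repeat apply Rmult_lt_0_compat; lra).
      pose proof (pow2_ge_0 (al * U - be * V - ka * W)).
      destruct (Req_dec X1 0) as [h0 | h0]; [| pose proof (pos _ _ H h0); lra].
      assert (hV : V = 0) by (unfold V; rewrite h0; ring).
      assert (hW : W = 0) by (unfold W; rewrite h0; ring).
      rewrite hV, hW, h0.
      apply Rlt_le_trans with (1 * (al * U) ^ 2); [| right; ring].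
      apply pos; [lra | apply Rmult_integral_contrapositive_currified; lra].
    + replace ((ka * W - al * U - be * V) ^ 2 - 4 * (- be * V) * (- al * U))
        with ((be * V - al * U - ka * W) ^ 2 + 4 * (al * ka) * Y1 ^ 2 * - V)
        by (unfold U, V, W; ring).
      assert (0 < 4 * (al * ka) * - V) by (repeat apply Rmult_lt_0_compat; lra).
      pose proof (pow2_ge_0 (be * V - al * U - ka * W)).
      destruct (Req_dec Y1 0) as [h0 | h0]; [| pose proof (pos _ _ H h0); lra].
      assert (hV : U = 0) by (unfold U; rewrite h0; ring).
      assert (hW : W = 0) by (unfold W; rewrite h0; ring).
      rewrite hV, hW, h0.
      apply Rlt_le_trans with (1 * (be * V) ^ 2); [| right; ring].
      apply pos; [lra | apply Rmult_integral_contrapositive_currified; lra].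
    + replace ((ka * W - al * U - be * V) ^ 2 - 4 * (- be * V) * (- al * U))
        with ((ka * W - al * U - be * V) ^ 2 + 4 * (al * be) * Z1 ^ 2 * - W)
        by (unfold U, V, W; ring).
      assert (0 < 4 * (al * be) * - W) by (repeat apply Rmult_lt_0_compat; lra).
      pose proof (pow2_ge_0 (ka * W - al * U - be * V)).
      destruct (Req_dec Z1 0) as [h0 | h0]; [| pose proof (pos _ _ H h0); lra].
      assert (hV : V = 0) by (unfold V; rewrite h0; ring).
      assert (hW : U = 0) by (unfold U; rewrite h0; ring).
      rewrite hV, hW, h0.
      apply Rlt_le_trans with (1 * (ka * W) ^ 2); [| right; ring].
      apply pos; [lra | apply Rmult_integral_contrapositive_currified; lra].
  - exists X2, Y2, X3, Y3; split; [| split; [| exact h]].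
    + rewrite <- e2; unfold chord_form, U, V, W, Z1; ring.
    + rewrite <- e3; unfold chord_form, U, V, W, Z1; ring.
Qed.

Lemma cross_antisym (X1 Y1 X2 Y2 : R) : cross X1 Y1 X2 Y2 = - cross X2 Y2 X1 Y1.
Proof. unfold cross; ring. Qed.

Lemma cross_ne0 (X1 Y1 X2 Y2 : R) :
  cross X1 Y1 X2 Y2 <> 0 -> (X1 <> 0 \/ Y1 <> 0) /\ (X2 <> 0 \/ Y2 <> 0).
Proof.
  unfold cross; intros h; split.
  - destruct (Req_dec X1 0) as [e |]; [| tauto].
    destruct (Req_dec Y1 0) as [e' |]; [| tauto].
    exfalso; apply h; rewrite e, e'; ring.
  - destruct (Req_dec X2 0) as [e |]; [| tauto].
    destruct (Req_dec Y2 0) as [e' |]; [| tauto].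
    exfalso; apply h; rewrite e, e'; ring.
Qed.

(** * Porism for the circumconic and the inconic *)

Lemma circumconic_inconic_porism (a b c A B C : R) h h' :
  0 < a -> 0 < b -> 0 < c -> 0 < A -> 0 < B -> 0 < C ->
  (forall X Y : R, X <> 0 \/ Y <> 0 -> infinity_form a b c X Y <> 0) ->
  porism3 (circumconic a b c h) (inconic A B C h').
Proof.
  intros ha hb hc hA hB hC hinf P hP.
  destruct (param_exists _ _ _ _ _ hP) as [X1 [Y1 [h1 p1]]].
  assert (hal : 0 < a * A) by (apply Rmult_lt_0_compat; assumption).
  assert (hbe : 0 < b * B) by (apply Rmult_lt_0_compat; assumption).
  assert (hka : 0 < c * C) by (apply Rmult_lt_0_compat; assumption).
  pose proof (chord_form_diag _ _ _ X1 Y1 hal hbe hka h1) as h11.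
  destruct (chord_form_roots _ _ _ X1 Y1 hal hbe hka h1)
    as [X2 [Y2 [X3 [Y3 [e2 [e3 h23]]]]]].
  pose proof (chord_form_closes _ _ _ _ _ _ _ _ _ h11 h23 e2 e3) as e23.
  destruct (cross_ne0 _ _ _ _ h23) as [h2 h3].
  (* A root equal to the parameter of [P] would be a zero of the form on the diagonal. *)
  assert (hne : forall X Y, X <> 0 \/ Y <> 0 ->
    chord_form (a * A) (b * B) (c * C) X1 Y1 X Y = 0 -> cross X1 Y1 X Y <> 0).
  { intros X Y hXY e h0.
    destruct (cross_eq0 _ _ _ _ h1 h0) as [k [-> ->]].
    rewrite chord_form_scale in e; apply Rmult_integral in e.
    destruct e as [e | e]; [| tauto].
    assert (k <> 0) by (intros ->; destruct hXY as [hXY | hXY]; apply hXY; ring).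
    apply (pow_nonzero k 2); assumption. }
  pose proof (hne _ _ h2 e2) as h12; pose proof (hne _ _ h3 e3) as h13.
  (* Since the conic misses the line at infinity, both roots give points of the affine plane. *)
  destruct (param_pointP a b c h X2 Y2) as [hQ p2]; [apply hinf, h2 |].
  destruct (param_pointP a b c h X3 Y3) as [hT p3]; [apply hinf, h3 |].
  set (Q := param_point a b c X2 Y2) in *; set (T := param_point a b c X3 Y3) in *.
  assert (h31 : cross X3 Y3 X1 Y1 <> 0) by (rewrite cross_antisym; lra).
  assert (hcol : ~ collinear P Q T).
  { exact (param_not_collinear _ _ _ h _ _ _ _ _ _ _ _ _ p1 p2 p3 h12 h23 h31). }
  assert (hPQ : P <> Q) by (intros e; apply hcol; rewrite e; apply collinear_diag).
  assert (hQT : Q <> T) by (intros e; apply hcol; rewrite e; apply collinear_right).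
  assert (hTP : T <> P) by (intros e; apply hcol; rewrite e; apply collinear_ends).
  exists Q, T.
  split; [exact hQ |]; split; [exact hT |]; split; [exact hcol |].
  split; [| split; [| split]].
  - apply (touches_chord _ _ _ h _ _ _ h' _ _ _ _ _ _ hA hB hC p1 p2 hPQ), e2.
  - apply (touches_chord _ _ _ h _ _ _ h' _ _ _ _ _ _ hA hB hC p2 p3 hQT), e23.
  - apply (touches_chord _ _ _ h _ _ _ h' _ _ _ _ _ _ hA hB hC p3 p1 hTP).
    rewrite chord_form_sym; exact e3.
  - intros S hS tS.
    destruct (param_exists _ _ _ _ _ hS) as [X [Y [hXY p]]].
    assert (hPS : P <> S) by apply tS.
    apply (touches_chord _ _ _ h _ _ _ h' _ _ _ _ _ _ hA hB hC p1 p hPS) in tS.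
    destruct (chord_form_zeros _ _ _ _ _ _ _ _ _ X Y h11 h23 e2 e3 tS) as [e | e].
    + left; symmetry; exact (param_inj _ _ _ _ _ _ _ _ _ p2 p e).
    + right; symmetry; exact (param_inj _ _ _ _ _ _ _ _ _ p3 p e).
Qed.

(** The parameters [1 : n] are distinct, and [n] is recovered from the ratio of the first two
    coordinates. *)
Lemma circumconic_points (a b c : R) h :
  (forall X Y : R, X <> 0 \/ Y <> 0 -> infinity_form a b c X Y <> 0) ->
  exists f : nat -> point, (forall m n, f m = f n -> m = n) /\
    forall n, on_conic (circumconic a b c h) (f n).
Proof.
  intros hinf.
  assert (ha : a <> 0) by (intros e; apply h; rewrite e; ring).
  assert (hb : b <> 0) by (intros e; apply h; rewrite e; ring).
  assert (hf : forall n : nat,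
    on_conic (circumconic a b c h) (param_point a b c 1 (INR n)) /\
    has_param a b c (param_point a b c 1 (INR n)) 1 (INR n)).
  { intros n; apply param_pointP, hinf; lra. }
  exists (fun n => param_point a b c 1 (INR n)).
  split; [| intros n; apply hf].
  intros m n e.
  destruct (hf m) as [_ [k [hk [p1 [p2 _]]]]].
  destruct (hf n) as [_ [l [hl [q1 [q2 _]]]]].
  rewrite <- e in q1, q2.
  pose proof (pos_INR m); pose proof (pos_INR n).
  assert (e2 : k * (1 + INR m) = l * (1 + INR n)).
  { apply (Rmult_eq_reg_l b); trivial; lra. }
  assert (e1 : k * (1 + INR m) * INR m = l * (1 + INR n) * INR n).
  { apply (Rmult_eq_reg_l a); trivial; lra. }
  rewrite <- e2 in e1.
  apply Rmult_eq_reg_l in e1; [apply INR_eq, e1 |].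
  apply Rmult_integral_contrapositive_currified; lra.
Qed.

(** * Angles and trisectors *)

Definition side_len (P Q : point) : R := dist_euc (fst P) (snd P) (fst Q) (snd Q).

(** Twice the signed area. The body is that of [collinear], so a proof of [~ collinear] is directly
    a proof that it is non-zero. *)
Definition area2 (P Q T : point) : R :=
  (fst Q - fst P) * (snd T - snd P) - (snd Q - snd P) * (fst T - fst P).

Lemma side_len_sym (P Q : point) : side_len P Q = side_len Q P.
Proof. apply distance_symm. Qed.

Lemma side_len_sqr (P Q : point) :
  side_len P Q * side_len P Q = (fst Q - fst P) ^ 2 + (snd Q - snd P) ^ 2.
Proof.
  unfold side_len, dist_euc; rewrite sqrt_sqrt; [unfold Rsqr; ring |].
  apply Rplus_le_le_0_compat; apply Rle_0_sqr.
Qed.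

Lemma side_len_pos (P Q : point) : P <> Q -> 0 < side_len P Q.
Proof.
  intros hPQ.
  assert (h : 0 <= side_len P Q) by apply sqrt_pos.
  destruct h as [h | h]; trivial; exfalso; apply hPQ.
  pose proof (side_len_sqr P Q) as e; rewrite <- h in e.
  pose proof (pow2_ge_0 (fst Q - fst P)); pose proof (pow2_ge_0 (snd Q - snd P)).
  assert (zero : forall x y, (y - x) ^ 2 = 0 -> x = y).
  { intros x y hxy; apply Rmult_integral in hxy; destruct hxy; lra. }
  apply point_eq; apply zero; lra.
Qed.

Lemma angle_sym (P V T : point) : angle P V T = angle T V P.
Proof.
  unfold angle; f_equal; f_equal; [ring | apply Rmult_comm].
Qed.

Lemma angle_bounds (P V T : point) : 0 <= angle P V T <= PI.
Proof. apply acos_bound. Qed.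

(** Lagrange's identity for the dot product and [area2] bounds the argument of [acos] and determines
    the sine up to sign. The absolute value reflects that the angle is unoriented. *)
Lemma angle_cos_sin (P V T : point) :
  V <> P -> V <> T ->
  side_len V P * side_len V T * cos (angle P V T)
    = (fst P - fst V) * (fst T - fst V) + (snd P - snd V) * (snd T - snd V) /\
  side_len V P * side_len V T * sin (angle P V T) = Rabs (area2 V P T).
Proof.
  intros hP hT.
  pose proof (side_len_pos _ _ hP) as d1; pose proof (side_len_pos _ _ hT) as d2.
  pose proof (side_len_sqr V P) as s1; pose proof (side_len_sqr V T) as s2.
  unfold angle; fold (side_len V P) (side_len V T).
  set (m := side_len V P) in *; set (n := side_len V T) in *.
  set (dot := (fst P - fst V) * (fst T - fst V)
              + (snd P - snd V) * (snd T - snd V)).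
  assert (hmn : 0 < m * n) by (apply Rmult_lt_0_compat; assumption).
  assert (hlag : dot ^ 2 + area2 V P T ^ 2 = (m * n) ^ 2).
  { transitivity ((m * m) * (n * n)); [rewrite s1, s2 | ring].
    unfold dot, area2; ring. }
  set (x := dot / (m * n)).
  assert (hx : m * n * x = dot) by (unfold x; field; lra).
  assert (hx2 : (m * n) ^ 2 * (1 - x ^ 2) = area2 V P T ^ 2).
  { transitivity ((m * n) ^ 2 - (m * n * x) ^ 2); [ring | rewrite hx; lra]. }
  pose proof (pow2_ge_0 (area2 V P T)).
  assert (hb : 0 <= 1 - x ^ 2).
  { apply (Rmult_le_reg_l ((m * n) ^ 2)); [apply pow_lt, hmn | lra]. }
  assert (hx1 : -1 <= x <= 1) by nra.
  split.
  - rewrite cos_acos by exact hx1; exact hx.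
  - rewrite sin_acos by exact hx1.
    rewrite <- (sqrt_Rsqr (m * n)) by lra.
    rewrite <- sqrt_mult_alt by apply Rle_0_sqr.
    rewrite <- sqrt_Rsqr_abs; f_equal.
    unfold Rsqr in *; rewrite <- Rsqr_pow2 in *; unfold Rsqr in *; lra.
Qed.

Lemma noncollinear_ne (P Q T : point) :
  ~ collinear P Q T -> P <> Q /\ Q <> T /\ T <> P.
Proof.
  intros h; repeat split; intros e; apply h; rewrite e;
    unfold collinear; ring.
Qed.

Lemma angle_pos_lt_PI (P V T : point) :
  ~ collinear V P T -> 0 < angle P V T < PI.
Proof.
  intros h; destruct (noncollinear_ne _ _ _ h) as [h1 [_ h2]].
  destruct (angle_cos_sin P V T) as [_ hs]; [congruence | congruence |].
  pose proof (angle_bounds P V T) as hb.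
  assert (hne : sin (angle P V T) <> 0).
  { intros e; rewrite e, Rmult_0_r in hs; symmetry in hs.
    apply h; unfold collinear; destruct (Req_dec (area2 V P T) 0); trivial.
    exfalso; apply (Rabs_no_R0 (area2 V P T)); assumption. }
  split.
  - destruct hb as [[hb | hb] _]; trivial; exfalso; apply hne.
    rewrite <- hb; apply sin_0.
  - destruct hb as [_ [hb | hb]]; trivial; exfalso; apply hne.
    rewrite hb; apply sin_PI.
Qed.

(** Dot products and areas show that [al + be] has the cosine of [PI - ga] and a positive sine. It
    therefore lies below [PI], where [acos] recovers it. *)
Lemma triangle_angle_sum (A B C : point) :
  ~ collinear A B C -> angle B A C + angle C B A + angle A C B = PI.
Proof.
  intros h.
  assert (hB : ~ collinear B C A) by (intros h'; apply h, collinear_rot, collinear_rot, h').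
  assert (hC : ~ collinear C A B) by (intros h'; apply h, collinear_rot, h').
  destruct (noncollinear_ne _ _ _ h) as [nAB [nBC nCA]].
  pose proof (angle_pos_lt_PI B A C h) as bA.
  pose proof (angle_pos_lt_PI C B A hB) as bB.
  pose proof (angle_pos_lt_PI A C B hC) as bC.
  destruct (angle_cos_sin B A C) as [cA sA]; [congruence | congruence |].
  destruct (angle_cos_sin C B A) as [cB sB]; [congruence | congruence |].
  destruct (angle_cos_sin A C B) as [cC sC]; [congruence | congruence |].
  rewrite (side_len_sym B A) in *; rewrite (side_len_sym C A) in *; rewrite (side_len_sym C B) in *.
  assert (eB : area2 B C A = area2 A B C) by (unfold area2; ring).
  assert (eC : area2 C A B = area2 A B C) by (unfold area2; ring).
  rewrite eB in sB; rewrite eC in sC.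
  set (S := Rabs (area2 A B C)) in *.
  assert (hS : S * S = area2 A B C * area2 A B C).
  { unfold S; rewrite <- Rabs_mult; apply Rabs_pos_eq; nra. }
  pose proof (side_len_pos _ _ nAB) as pc; pose proof (side_len_pos _ _ nBC) as pa.
  assert (nAC : A <> C) by congruence; pose proof (side_len_pos _ _ nAC) as pb.
  pose proof (side_len_sqr A B) as qc; pose proof (side_len_sqr B C) as qa.
  pose proof (side_len_sqr A C) as qb.
  set (c := side_len A B) in *; set (a := side_len B C) in *; set (b := side_len A C) in *.
  set (al := angle B A C) in *; set (be := angle C B A) in *.
  set (ga := angle A C B) in *.
  assert (hk : (c * b) * (a * c) * (b * a) <> 0).
  { repeat apply Rmult_integral_contrapositive_currified; lra. }
  assert (hcos : cos (al + be) = - cos ga).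
  { rewrite cos_plus; apply (Rmult_eq_reg_l ((c * b) * (a * c) * (b * a)));
      [| exact hk].
    transitivity ((b * a) * ((c * b * cos al) * (a * c * cos be)
                   - (c * b * sin al) * (a * c * sin be))); [ring |].
    transitivity (- ((b * a) * (c * c) * (b * a * cos ga))); [| ring].
    rewrite cA, cB, cC, sA, sB, hS, qc; unfold area2; ring. }
  assert (hsin : 0 < sin (al + be)).
  { rewrite sin_plus; apply (Rmult_lt_reg_l ((c * b) * (a * c)));
      [repeat apply Rmult_lt_0_compat; lra |].
    rewrite Rmult_0_r.
    replace (c * b * (a * c) * (sin al * cos be + cos al * sin be))
      with ((c * b * sin al) * (a * c * cos be)
            + (c * b * cos al) * (a * c * sin be)) by ring.
    rewrite cA, cB, sA, sB.
    match goal with |- 0 < ?l => replace l with (S * (c * c)) end.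
    2: { rewrite qc; ring. }
    apply Rmult_lt_0_compat; [| nra].
    unfold S; apply Rabs_pos_lt, h. }
  assert (hlt : al + be < PI).
  { apply Rnot_le_lt; intros hle.
    assert (sin (al + be) <= 0); [apply sin_le_0; lra | lra]. }
  assert (e : al + be = PI - ga); [| lra].
  rewrite <- (acos_cos (al + be)) by lra.
  rewrite <- (acos_cos (PI - ga)) by lra.
  f_equal; rewrite hcos.
  rewrite cos_minus, cos_PI, sin_PI; ring.
Qed.

(* The point of the side PQ on the trisector adjacent to VP: by the law of
   sines its distances to VQ and VP are in the ratio sin 2al : sin al. *)
Lemma trisector_point (V P Q T : point) :
  ~ collinear V P Q -> segment P Q T -> angle P V T = angle P V Q / 3 ->
  exists t : R,
    fst T = (1 - t) * fst P + t * fst Q /\ snd T = (1 - t) * snd P + t * snd Q /\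
    (1 - t) * side_len V P = 2 * cos (angle P V Q / 3) * (t * side_len V Q).
Proof.
  intros h [t [[ht0 ht1] eT]] hang.
  destruct (noncollinear_ne _ _ _ h) as [nP [_ nQ]].
  pose proof (angle_pos_lt_PI P V Q h) as hb.
  assert (eT1 : fst T = (1 - t) * fst P + t * fst Q) by (rewrite eT; reflexivity).
  assert (eT2 : snd T = (1 - t) * snd P + t * snd Q) by (rewrite eT; reflexivity).
  exists t; split; [exact eT1 |]; split; [exact eT2 |]; clear eT.
  assert (nT : V <> T).
  { intros e; apply h; unfold collinear; rewrite e, eT1, eT2; ring. }
  assert (nQ' : V <> Q) by congruence.
  destruct (angle_cos_sin P V T nP nT) as [cT sT].
  destruct (angle_cos_sin P V Q nP nQ') as [cQ sQ].
  rewrite hang in cT, sT.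
  set (al := angle P V Q / 3) in *.
  assert (e3 : angle P V Q = al + 2 * al) by (unfold al; field).
  pose proof (side_len_pos _ _ nP) as pP; pose proof (side_len_pos _ _ nQ') as pQ.
  pose proof (side_len_pos _ _ nT) as pT; pose proof (side_len_sqr V P) as qP.
  assert (hsal : 0 < sin al) by (apply sin_gt_0; unfold al; lra).
  assert (ear : area2 V P T = t * area2 V P Q).
  { unfold area2; rewrite eT1, eT2; ring. }
  rewrite ear, Rabs_mult, (Rabs_pos_eq t), <- sQ in sT by exact ht0.
  set (u := side_len V P) in *; set (v := side_len V Q) in *; set (w := side_len V T) in *.
  (* [h1] and [h2] give the components of [VT] along [VP] and perpendicular to it. *)
  assert (h1 : w * cos al = (1 - t) * u + t * (v * cos (angle P V Q))).
  { apply (Rmult_eq_reg_l u); [| lra].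
    transitivity (u * w * cos al); [ring |].
    transitivity ((1 - t) * (u * u) + t * (u * v * cos (angle P V Q))); [| ring].
    rewrite cT, cQ, qP, eT1, eT2; ring. }
  assert (h2 : w * sin al = t * (v * sin (angle P V Q))).
  { apply (Rmult_eq_reg_l u); [| lra].
    transitivity (u * w * sin al); [ring | rewrite sT; ring]. }
  rewrite e3 in h1, h2.
  assert (es : sin (2 * al) = 2 * sin al * cos al) by apply sin_2a.
  apply (Rmult_eq_reg_r (sin al)); [| lra].
  transitivity (t * v * sin (2 * al)); [| rewrite es; ring].
  (* Writing [2 al] as the whole angle minus [al] brings in exactly the quantities of [h1] and
     [h2]. *)
  replace (2 * al) with ((al + 2 * al) - al) at 1 by ring.
  rewrite sin_minus.
  transitivity (cos al * (w * sin al) - sin al * (t * (v * cos (al + 2 * al)))).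
  - replace ((1 - t) * u) with (w * cos al - t * (v * cos (al + 2 * al))) by lra.
    ring.
  - rewrite h2; ring.
Qed.

Lemma trisectorsP (V P Q T1 T2 : point) :
  ~ collinear V P Q -> trisectors V P Q T1 T2 ->
  (exists t : R,
    fst T1 = (1 - t) * fst P + t * fst Q /\ snd T1 = (1 - t) * snd P + t * snd Q /\
    (1 - t) * side_len V P = 2 * cos (angle P V Q / 3) * (t * side_len V Q)) /\
  (exists t : R,
    fst T2 = (1 - t) * fst P + t * fst Q /\ snd T2 = (1 - t) * snd P + t * snd Q /\
    t * side_len V Q = 2 * cos (angle P V Q / 3) * ((1 - t) * side_len V P)).
Proof.
  intros h [s1 [s2 [a1 [_ a2]]]]; split.
  - apply trisector_point; assumption.
  - destruct (trisector_point V Q P T2) as [t [e1 [e2 e3]]].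
    + intros h'; apply h, collinear_rot, collinear_swap12, h'.
    + destruct s2 as [t [ht e]]; exists (1 - t); split; [lra |].
      rewrite e; f_equal; ring.
    + rewrite (angle_sym Q V T2), (angle_sym Q V P); exact a2.
    + exists (1 - t); rewrite e1, e2; rewrite (angle_sym Q V P) in e3.
      split; [ring |]; split; [ring |].
      rewrite e3; ring.
Qed.

(** * Trigonometry of angles with sum PI/3 *)

Lemma sin_PI3_sqr : sin (PI / 3) ^ 2 = 3 / 4.
Proof.
  pose proof (sin2_cos2 (PI / 3)) as h; rewrite cos_PI3 in h.
  unfold Rsqr in h; lra.
Qed.

(** With [ga = PI/3 - (al + be)] and [4 sin(PI/3)^2 = 3] both sides have the same expansion. This
    gives the sign of [p q - r] and the factors shared by both sides of the discriminant
    inequality. *)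
Lemma cos_mul_sub_cos (al be ga : R) :
  al + be + ga = PI / 3 ->
  2 * cos al * (2 * cos be) - 2 * cos ga
  = 2 * sin (PI / 3 - al) * (2 * sin (PI / 3 - be)).
Proof.
  intros h; replace ga with (PI / 3 - (al + be)) by lra.
  rewrite !sin_minus, cos_minus, cos_plus, sin_plus, cos_PI3.
  pose proof sin_PI3_sqr as h3; set (s := sin (PI / 3)) in *.
  transitivity (3 * (cos al * cos be) + sin al * sin be
    - 2 * s * (sin al * cos be + cos al * sin be)); [field |].
  replace 3 with (4 * s ^ 2) by lra; field.
Qed.

Lemma four_cos_sqr_sub1 (al : R) :
  (2 * cos al) ^ 2 - 1 = 2 * sin (PI / 3 - al) * (2 * sin (PI / 3 + al)).
Proof.
  rewrite sin_minus, sin_plus, cos_PI3.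
  pose proof sin_PI3_sqr as h3; set (s := sin (PI / 3)) in *.
  pose proof (sin2_cos2 al) as h; unfold Rsqr in h.
  transitivity (4 * s ^ 2 * cos al ^ 2 - sin al * sin al);
    [rewrite h3; lra | field].
Qed.

Lemma sin_mul_sin_shift (al be ga : R) :
  al + be + ga = PI / 3 ->
  2 * sin (PI / 3 + be) * (2 * sin (PI / 3 + ga))
  = 2 * cos be * (2 * cos ga) + 2 * cos (PI / 3 + al).
Proof.
  intros h; replace (PI / 3 + al) with (PI / 3 + PI / 3 - (be + ga)) by lra.
  rewrite cos_minus, !sin_plus, !cos_plus, cos_PI3.
  pose proof sin_PI3_sqr as h3; set (s := sin (PI / 3)) in *.
  transitivity (4 * s ^ 2 * (cos be * cos ga) + sin be * sin ga
    + 2 * s * (sin be * cos ga + cos be * sin ga)); [field |].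
  transitivity (4 * (cos be * cos ga) - 2 * (s ^ 2 - 1 / 4)
      * (cos be * cos ga - sin be * sin ga)
    + 2 * s * (sin be * cos ga + cos be * sin ga)); [rewrite h3; field | field].
Qed.

Lemma one_lt_two_cos (al : R) : 0 < al < PI / 3 -> 1 < 2 * cos al.
Proof.
  intros h; pose proof PI_RGT_0.
  assert (cos (PI / 3) < cos al) by (apply cos_decreasing_1; lra).
  rewrite cos_PI3 in *; lra.
Qed.

Lemma cos_lt_cos_mul_cos (al be ga : R) :
  al + be + ga = PI / 3 -> 0 < al -> 0 < be -> 0 < ga ->
  2 * cos ga < 2 * cos al * (2 * cos be).
Proof.
  intros h h1 h2 h3; pose proof PI_RGT_0.
  apply Rlt_0_minus; rewrite (cos_mul_sub_cos _ _ _ h).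
  assert (0 < sin (PI / 3 - al)) by (apply sin_gt_0; lra).
  assert (0 < sin (PI / 3 - be)) by (apply sin_gt_0; lra).
  repeat apply Rmult_lt_0_compat; lra.
Qed.

(* With n = pqr and k = cos (PI/3 - al), the difference of the two sides is a
   positive multiple of (n - 1) (k^2 (n - 1) + 1). *)
Lemma side_discriminant_lt (al be ga : R) :
  al + be + ga = PI / 3 -> 0 < al -> 0 < be -> 0 < ga ->
  let p := 2 * cos al in
  let q := 2 * cos be in
  let r := 2 * cos ga in
  (p * q * r + 1) ^ 2 * ((p * q - r) * (p * r - q))
  < 4 * p ^ 2 * (q * r) * ((q ^ 2 - 1) * (r ^ 2 - 1)).
Proof.
  intros h h1 h2 h3 p q r; pose proof PI_RGT_0.
  assert (hp : 1 < p) by (apply one_lt_two_cos; lra).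
  assert (hq : 1 < q) by (apply one_lt_two_cos; lra).
  assert (hr : 1 < r) by (apply one_lt_two_cos; lra).
  assert (sb : 0 < sin (PI / 3 - be)) by (apply sin_gt_0; lra).
  assert (sc : 0 < sin (PI / 3 - ga)) by (apply sin_gt_0; lra).
  assert (h' : al + ga + be = PI / 3) by lra.
  unfold p, q, r.
  rewrite (cos_mul_sub_cos _ _ _ h), (cos_mul_sub_cos _ _ _ h').
  rewrite !four_cos_sqr_sub1; fold p q r.
  pose proof (sin_mul_sin_shift _ _ _ h) as hT; fold q r in hT.
  set (sal := sin (PI / 3 - al)) in *.
  set (sbe := sin (PI / 3 - be)) in *; set (sga := sin (PI / 3 - ga)) in *.
  apply Rlt_0_minus.
  set (k := cos (PI / 3 - al)).
  set (n := p * q * r).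
  assert (hn : 1 < n).
  { unfold n; assert (1 < p * q) by nra; nra. }
  (* What remains of the difference of the two sides after the positive common factor [16 sbe sga]
     is taken out. *)
  assert (key : p ^ 2 * (q * r) * (q * r + 2 * cos (PI / 3 + al))
    - (n + 1) ^ 2 * sal ^ 2 = (n - 1) * (k ^ 2 * (n - 1) + 1)).
  { assert (hk : k ^ 2 = 1 - sal ^ 2).
    { pose proof (sin2_cos2 (PI / 3 - al)) as e; unfold Rsqr in e.
      fold k sal in e; lra. }
    assert (hc : p * (2 * cos (PI / 3 + al)) = 4 * sal ^ 2 - 1).
    { unfold sal, p; rewrite sin_minus, cos_plus, cos_PI3.
      pose proof sin_PI3_sqr as h3'; set (s := sin (PI / 3)) in *.
      pose proof (sin2_cos2 al) as e; unfold Rsqr in e.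
      transitivity (4 * s ^ 2 * cos al ^ 2 - 4 * s * cos al * sin al
        + sin al ^ 2 - (sin al * sin al + cos al * cos al));
        [rewrite h3'; field | rewrite e; field]. }
    rewrite hk.
    transitivity (n ^ 2 + n * (p * (2 * cos (PI / 3 + al)))
                  - (n + 1) ^ 2 * sal ^ 2); [unfold n; ring |].
    rewrite hc; ring. }
  match goal with |- 0 < ?l =>
    replace l with (16 * (sbe * sga) * ((n - 1) * (k ^ 2 * (n - 1) + 1))) end.
  - pose proof (pow2_ge_0 k).
    repeat apply Rmult_lt_0_compat; try lra.
    assert (0 <= k ^ 2 * (n - 1)) by (apply Rmult_le_pos; lra); lra.
  - rewrite <- key.
    transitivity (4 * (sbe * sga)
      * (4 * p ^ 2 * (q * r) * (q * r + 2 * cos (PI / 3 + al))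
         - 4 * (n + 1) ^ 2 * sal ^ 2)); [ring |].
    rewrite <- hT; unfold n; ring.
Qed.

(** * The two conics in trilinear coordinates *)

(** The form is [- b X^2 + (c - a - b) X Y - a Y^2]; the hypothesis says that its discriminant is
    negative. *)
Lemma infinity_form_neg (a b c X Y : R) :
  0 < b -> a ^ 2 + b ^ 2 + c ^ 2 < 2 * (a * b + b * c + c * a) ->
  X <> 0 \/ Y <> 0 -> infinity_form a b c X Y < 0.
Proof.
  intros hb hd hXY; unfold infinity_form.
  set (D := 2 * (a * b + b * c + c * a) - (a ^ 2 + b ^ 2 + c ^ 2)).
  assert (hD : 0 < D) by (unfold D; lra).
  assert (e : 4 * b * - (c * X * Y - (a * Y + b * X) * (X + Y))
              = (2 * b * X + (a + b - c) * Y) ^ 2 + D * Y ^ 2)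
    by (unfold D; ring).
  assert (0 < (2 * b * X + (a + b - c) * Y) ^ 2 + D * Y ^ 2).
  { destruct (Req_dec Y 0) as [h0 | h0].
    - destruct hXY as [hX | hX]; [| contradiction]; rewrite h0.
      replace ((2 * b * X + (a + b - c) * 0) ^ 2 + D * 0 ^ 2)
        with ((2 * b * X) ^ 2) by ring.
      assert (2 * b * X <> 0)
        by (repeat apply Rmult_integral_contrapositive_currified; lra).
      pose proof (pow2_ge_0 (2 * b * X)); pose proof (pow_nonzero _ 2 H); lra.
    - pose proof (pow2_ge_0 (2 * b * X + (a + b - c) * Y)).
      assert (0 < D * Y ^ 2); [| lra].
      apply Rmult_lt_0_compat; trivial.
      pose proof (pow2_ge_0 Y); pose proof (pow_nonzero _ 2 h0); lra. }
  nra.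
Qed.

(* The numbers p, q, r stand for 2 cos of the thirds of the angles. *)
Definition admissible (p q r : R) : Prop :=
  (1 < p /\ 1 < q /\ 1 < r) /\ (p < q * r /\ q < p * r /\ r < p * q) /\
  (p * q * r + 1) ^ 2 * ((p * q - r) * (p * r - q))
    < 4 * p ^ 2 * (q * r) * ((q ^ 2 - 1) * (r ^ 2 - 1)) /\
  (p * q * r + 1) ^ 2 * ((p * q - r) * (q * r - p))
    < 4 * q ^ 2 * (p * r) * ((p ^ 2 - 1) * (r ^ 2 - 1)) /\
  (p * q * r + 1) ^ 2 * ((p * r - q) * (q * r - p))
    < 4 * r ^ 2 * (p * q) * ((p ^ 2 - 1) * (q ^ 2 - 1)).

Lemma trisected_admissible (al be ga : R) :
  al + be + ga = PI / 3 -> 0 < al -> 0 < be -> 0 < ga ->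
  admissible (2 * cos al) (2 * cos be) (2 * cos ga).
Proof.
  intros h ha hb hc.
  assert (h1 : be + ga + al = PI / 3) by lra.
  assert (h2 : ga + al + be = PI / 3) by lra.
  split; [| split].
  - repeat split; apply one_lt_two_cos; lra.
  - split; [| split].
    + apply cos_lt_cos_mul_cos; lra.
    + apply cos_lt_cos_mul_cos; lra.
    + apply cos_lt_cos_mul_cos; lra.
  - pose proof (side_discriminant_lt _ _ _ h ha hb hc) as d1.
    pose proof (side_discriminant_lt _ _ _ h1 hb hc ha) as d2.
    pose proof (side_discriminant_lt _ _ _ h2 hc ha hb) as d3.
    cbv zeta in *.
    set (p := 2 * cos al) in *; set (q := 2 * cos be) in *.
    set (r := 2 * cos ga) in *.
    split; [exact d1 | split].
    + replace ((p * q * r + 1) ^ 2 * ((p * q - r) * (q * r - p)))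
        with ((q * r * p + 1) ^ 2 * ((q * r - p) * (q * p - r))) by ring.
      replace (4 * q ^ 2 * (p * r) * ((p ^ 2 - 1) * (r ^ 2 - 1)))
        with (4 * q ^ 2 * (r * p) * ((r ^ 2 - 1) * (p ^ 2 - 1))) by ring.
      exact d2.
    + replace ((p * q * r + 1) ^ 2 * ((p * r - q) * (q * r - p)))
        with ((r * p * q + 1) ^ 2 * ((r * p - q) * (r * q - p))) by ring.
      exact d3.
Qed.

(* The weights of the circumconic on the lines y = p z, z = q x, x = r y, when
   the line at infinity is [l1 (p z - y) + l2 (q x - z) + l3 (r y - x) = 0]. *)
Lemma trilinear_infinity_form (p q r la lb lc X Y : R) :
  admissible p q r -> 0 < la -> 0 < lb -> 0 < lc -> X <> 0 \/ Y <> 0 ->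
  infinity_form ((lb + r * la + q * r * lc) * ((p ^ 2 - 1) * r * (q * r - p)))
    ((lc + p * lb + r * p * la) * ((q ^ 2 - 1) * p * (p * r - q)))
    ((la + q * lc + p * q * lb) * ((r ^ 2 - 1) * q * (p * q - r))) X Y <> 0.
Proof.
  intros [[hp [hq hr]] [[hd [he hf]] [d1 [d2 d3]]]] ha hb hc hXY.
  set (P := p ^ 2 - 1) in *; set (Q := q ^ 2 - 1) in *; set (R := r ^ 2 - 1) in *.
  assert (hP : 0 < P) by (unfold P; nra).
  assert (hQ : 0 < Q) by (unfold Q; nra).
  assert (hR : 0 < R) by (unfold R; nra).
  set (d := q * r - p) in *; set (e := p * r - q) in *; set (f := p * q - r) in *.
  assert (hd' : 0 < d) by (unfold d; lra).
  assert (he' : 0 < e) by (unfold e; lra).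
  assert (hf' : 0 < f) by (unfold f; lra).
  (* The line at infinity is a positive combination of the three side lines,
     none of which meets the circumconic. *)
  assert (h1 : infinity_form (r * (P * r * d)) (r * p * (Q * p * e)) (R * q * f)
                 X Y < 0).
  { apply infinity_form_neg; trivial.
    - repeat apply Rmult_lt_0_compat; lra.
    - apply Rlt_0_minus.
      (* Up to the positive factor [e f], this is the gap in the inequality of [admissible] for the
         side BC. *)
      replace (_ - _) with ((e * f) * (4 * p ^ 2 * (q * r) * (Q * R)
        - (p * q * r + 1) ^ 2 * (f * e))).
      + repeat apply Rmult_lt_0_compat; lra.
      + unfold P, Q, R, d, e, f; ring. }
  assert (h2 : infinity_form (P * r * d) (p * (Q * p * e)) (p * q * (R * q * f))
                 X Y < 0).
  { apply infinity_form_neg; trivial.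
    - repeat apply Rmult_lt_0_compat; lra.
    - apply Rlt_0_minus.
      replace (_ - _) with ((f * d) * (4 * q ^ 2 * (p * r) * (P * R)
        - (p * q * r + 1) ^ 2 * (f * d))).
      + repeat apply Rmult_lt_0_compat; lra.
      + unfold P, Q, R, d, e, f; ring. }
  assert (h3 : infinity_form (q * r * (P * r * d)) (Q * p * e) (q * (R * q * f))
                 X Y < 0).
  { apply infinity_form_neg; trivial.
    - repeat apply Rmult_lt_0_compat; lra.
    - apply Rlt_0_minus.
      replace (_ - _) with ((e * d) * (4 * r ^ 2 * (p * q) * (P * Q)
        - (p * q * r + 1) ^ 2 * (e * d))).
      + repeat apply Rmult_lt_0_compat; lra.
      + unfold P, Q, R, d, e, f; ring. }
  match type of h1 with ?F1 < 0 => match type of h2 with ?F2 < 0 =>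
    match type of h3 with ?F3 < 0 =>
      assert (la * F1 + lb * F2 + lc * F3 < 0);
      [| match goal with |- ?g <> 0 =>
           assert (eq : g = la * F1 + lb * F2 + lc * F3)
             by (unfold infinity_form; ring) end]
  end end end.
  - pose proof (Rmult_lt_0_compat _ _ ha (Ropp_gt_lt_0_contravar _ h1)).
    pose proof (Rmult_lt_0_compat _ _ hb (Ropp_gt_lt_0_contravar _ h2)).
    pose proof (Rmult_lt_0_compat _ _ hc (Ropp_gt_lt_0_contravar _ h3)).
    lra.
  - lra.
Qed.

(* x, y, z are trilinear coordinates with respect to the triangle ABC, and f
   sends the sides of the triangle X1 Y1 Z1 to those of the normalized one. *)
Lemma trilinear_porism (x y z : point -> R) (la lb lc p q r : R) (f : affine_iso)
    (A B C A1 A2 B1 B2 C1 C2 X1 Y1 Z1 X2 Y2 Z2 : point) :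
  admissible p q r -> 0 < la -> 0 < lb -> 0 < lc ->
  (forall T, la * x T + lb * y T + lc * z T = 1) ->
  let l1 := lb + r * la + q * r * lc in
  let l2 := lc + p * lb + r * p * la in
  let l3 := la + q * lc + p * q * lb in
  (forall T, (p * q * r - 1) * fst (aff f T) = l1 * (p * z T - y T)) ->
  (forall T, (p * q * r - 1) * snd (aff f T) = l2 * (q * x T - z T)) ->
  y A = 0 -> z A = 0 -> z B = 0 -> x B = 0 -> x C = 0 -> y C = 0 ->
  A <> A1 -> A <> A2 -> B <> B1 -> B <> B2 -> C <> C1 -> C <> C2 ->
  y A1 = p * z A1 -> z A2 = p * y A2 ->
  z B1 = q * x B1 -> x B2 = q * z B2 ->
  x C1 = r * y C1 -> y C2 = r * x C2 ->
  z X1 = q * x X1 -> x X1 = r * y X1 ->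
  y Y1 = p * z Y1 -> x Y1 = r * y Y1 ->
  y Z1 = p * z Z1 -> z Z1 = q * x Z1 ->
  x X2 = q * z X2 -> y X2 = r * x X2 ->
  z Y2 = p * y Y2 -> y Y2 = r * x Y2 ->
  z Z2 = p * y Z2 -> x Z2 = q * z Z2 ->
  exists K1 K2 : conic,
    (on_conic K1 X1 /\ on_conic K1 Y1 /\ on_conic K1 Z1 /\
     on_conic K1 X2 /\ on_conic K1 Y2 /\ on_conic K1 Z2) /\
    (touches A A1 K2 /\ touches A A2 K2 /\
     touches B B1 K2 /\ touches B B2 K2 /\
     touches C C1 K2 /\ touches C C2 K2) /\
    poncelet_chain K1 K2 (cycle3 X1 Y1 Z1) /\
    poncelet_chain K1 K2 (cycle3 X2 Y2 Z2) /\
    porism3 K1 K2 /\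
    ~ Finite (Ensemble point) (poncelet_triangles K1 K2).
Proof.
  intros hadm ha hb hc hsum l1 l2 l3 hf1 hf2 yA zA zB xB xC yC
    nA1 nA2 nB1 nB2 nC1 nC2 eA1 eA2 eB1 eB2 eC1 eC2
    eX1 eX1' eY1 eY1' eZ1 eZ1' eX2 eX2' eY2 eY2' eZ2 eZ2'.
  assert (hinf : forall X Y, X <> 0 \/ Y <> 0 ->
    infinity_form (l1 * ((p ^ 2 - 1) * r * (q * r - p)))
      (l2 * ((q ^ 2 - 1) * p * (p * r - q)))
      (l3 * ((r ^ 2 - 1) * q * (p * q - r))) X Y <> 0).
  { intros X Y; apply trilinear_infinity_form; assumption. }
  destruct hadm as [[hp [hq hr]] [[hd [he hf]] _]].
  assert (hpq : 1 < p * q) by nra.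
  assert (hn : 0 < p * q * r - 1) by nra.
  assert (pos : forall u v, 0 < u -> 0 < v -> 0 < u * v)
    by (intros; apply Rmult_lt_0_compat; assumption).
  assert (hl1 : 0 < l1).
  { unfold l1; assert (0 < q * r * lc) by (repeat apply pos; lra).
    assert (0 < r * la) by (apply pos; lra); lra. }
  assert (hl2 : 0 < l2).
  { unfold l2; assert (0 < r * p * la) by (repeat apply pos; lra).
    assert (0 < p * lb) by (apply pos; lra); lra. }
  assert (hl3 : 0 < l3).
  { unfold l3; assert (0 < p * q * lb) by (repeat apply pos; lra).
    assert (0 < q * lc) by (apply pos; lra); lra. }
  set (n := p * q * r - 1) in *.
  (* [l1], [l2], [l3] are chosen so that [l1 (p z - y) + l2 (q x - z) + l3 (r y - x) = n (la x + lb
     y + lc z)]. *)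
  assert (hf3 : forall T, n * third (aff f T) = l3 * (r * y T - x T)).
  { intros T; unfold third.
    transitivity (n * 1 - n * fst (aff f T) - n * snd (aff f T)); [ring |].
    rewrite hf1, hf2, <- (hsum T); unfold n, l1, l2, l3; ring. }
  assert (hP : 0 < p ^ 2 - 1) by nra.
  assert (hQ : 0 < q ^ 2 - 1) by nra.
  assert (hR : 0 < r ^ 2 - 1) by nra.
  (* The factors [l1], [l2], [l3] make the scaling drop out of the equation of [K1] in [p z - y],
     [q x - z], [r y - x]. The other factors are chosen so that [X2], [Y2], [Z2] lie on [K1]. *)
  set (a := l1 * ((p ^ 2 - 1) * r * (q * r - p))) in *.
  set (b := l2 * ((q ^ 2 - 1) * p * (p * r - q))) in *.
  set (c := l3 * ((r ^ 2 - 1) * q * (p * q - r))) in *.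
  assert (pa : 0 < a) by (unfold a; repeat apply pos; lra).
  assert (pb : 0 < b) by (unfold b; repeat apply pos; lra).
  assert (pc : 0 < c) by (unfold c; repeat apply pos; lra).
  set (A' := l2 * l3 * (r * (q * r - p))).
  set (B' := l3 * l1 * (p * (p * r - q))).
  set (C' := l1 * l2 * (q * (p * q - r))).
  assert (pA : 0 < A') by (unfold A'; repeat apply pos; lra).
  assert (pB : 0 < B') by (unfold B'; repeat apply pos; lra).
  assert (pC : 0 < C') by (unfold C'; repeat apply pos; lra).
  assert (h1 : a * b * c <> 0) by (apply Rgt_not_eq; repeat apply pos; lra).
  assert (h2 : A' * B' * C' <> 0) by (apply Rgt_not_eq; repeat apply pos; lra).
  set (K1 := pullback f (circumconic a b c h1)).
  set (K2 := pullback f (inconic A' B' C' h2)).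
  assert (hK1 : forall T,
    (p ^ 2 - 1) * r * (q * r - p) * ((q * x T - z T) * (r * y T - x T))
    + (q ^ 2 - 1) * p * (p * r - q) * ((r * y T - x T) * (p * z T - y T))
    + (r ^ 2 - 1) * q * (p * q - r) * ((p * z T - y T) * (q * x T - z T)) = 0 ->
    on_conic K1 T).
  { intros T hT; apply on_conic_pullback, on_circumconic.
    apply (Rmult_eq_reg_l (n ^ 2)); [| apply pow_nonzero; lra].
    rewrite Rmult_0_r, <- (Rmult_0_r (l1 * l2 * l3)), <- hT.
    transitivity (a * (n * snd (aff f T)) * (n * third (aff f T))
      + b * (n * third (aff f T)) * (n * fst (aff f T))
      + c * (n * fst (aff f T)) * (n * snd (aff f T))); [ring |].
    rewrite hf1, hf2, hf3; unfold a, b, c; ring. }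
  (* Line coordinates scale inversely to point coordinates: [u/l1 : v/l2 : w/l3], cleared of
     denominators. *)
  assert (hK2 : forall P Q u v w, P <> Q -> ~ (u = 0 /\ v = 0 /\ w = 0) ->
    A' * (v * l1 * l3) * (w * l1 * l2) + B' * (w * l1 * l2) * (u * l2 * l3)
      + C' * (u * l2 * l3) * (v * l1 * l3) = 0 ->
    u * (p * z P - y P) + v * (q * x P - z P) + w * (r * y P - x P) = 0 ->
    u * (p * z Q - y Q) + v * (q * x Q - z Q) + w * (r * y Q - x Q) = 0 ->
    touches P Q K2).
  { intros P Q u v w hPQ huvw hdual eP eQ; apply touches_pullback.
    assert (hl12 : l1 * l2 <> 0) by (apply Rgt_not_eq, pos; assumption).
    assert (hl23 : l2 * l3 <> 0) by (apply Rgt_not_eq, pos; assumption).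
    assert (hl13 : l1 * l3 <> 0) by (apply Rgt_not_eq, pos; assumption).
    assert (hline : forall T,
      u * (p * z T - y T) + v * (q * x T - z T) + w * (r * y T - x T) = 0 ->
      u * l2 * l3 * fst (aff f T) + v * l1 * l3 * snd (aff f T)
        + w * l1 * l2 * third (aff f T) = 0).
    { intros T eT; apply (Rmult_eq_reg_l n); [| lra].
      rewrite Rmult_0_r, <- (Rmult_0_r (l1 * l2 * l3)), <- eT.
      transitivity (u * l2 * l3 * (n * fst (aff f T))
        + v * l1 * l3 * (n * snd (aff f T))
        + w * l1 * l2 * (n * third (aff f T))); [ring |].
      rewrite hf1, hf2, hf3; ring. }
    apply (touches_inconic_of_line A' B' C' h2 _ _ (u * l2 * l3) (v * l1 * l3)
             (w * l1 * l2)); trivial; try (apply hline; assumption).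
    - intros e; apply hPQ, (aff_inj f), e.
    - rewrite !Rmult_assoc; intros [e1 [e2 e3]]; apply huvw.
      apply Rmult_integral in e1, e2, e3; tauto. }
  assert (tA1 : forall P Q, P <> Q -> y P = p * z P -> y Q = p * z Q ->
    touches P Q K2).
  { intros P Q hPQ e e'; apply (hK2 P Q 1 0 0); trivial; try lra; ring. }
  assert (tB1 : forall P Q, P <> Q -> z P = q * x P -> z Q = q * x Q ->
    touches P Q K2).
  { intros P Q hPQ e e'; apply (hK2 P Q 0 1 0); trivial; try lra; ring. }
  assert (tC1 : forall P Q, P <> Q -> x P = r * y P -> x Q = r * y Q ->
    touches P Q K2).
  { intros P Q hPQ e e'; apply (hK2 P Q 0 0 1); trivial; try lra; ring. }
  assert (tA2 : forall P Q, P <> Q -> z P = p * y P -> z Q = p * y Q ->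
    touches P Q K2).
  { intros P Q hPQ e e'.
    (* In this combination of the three forms [x] cancels and [n (z - p y)] is left; the other two
       second trisectors are obtained likewise. *)
    apply (hK2 P Q (q * r - p) (- (p ^ 2 - 1)) (- q * (p ^ 2 - 1))); trivial.
    - intros [h0 _]; lra.
    - unfold A', B', C'; ring.
    - rewrite e; ring.
    - rewrite e'; ring. }
  assert (tB2 : forall P Q, P <> Q -> x P = q * z P -> x Q = q * z Q ->
    touches P Q K2).
  { intros P Q hPQ e e'.
    apply (hK2 P Q (- r * (q ^ 2 - 1)) (p * r - q) (- (q ^ 2 - 1))); trivial.
    - intros [_ [h0 _]]; lra.
    - unfold A', B', C'; ring.
    - rewrite e; ring.
    - rewrite e'; ring. }
  assert (tC2 : forall P Q, P <> Q -> y P = r * x P -> y Q = r * x Q ->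
    touches P Q K2).
  { intros P Q hPQ e e'.
    apply (hK2 P Q (- (r ^ 2 - 1)) (- p * (r ^ 2 - 1)) (p * q - r)); trivial.
    - intros [_ [_ h0]]; lra.
    - unfold A', B', C'; ring.
    - rewrite e; ring.
    - rewrite e'; ring. }
  assert (kX1 : on_conic K1 X1) by (apply hK1; rewrite eX1, eX1'; ring).
  assert (kY1 : on_conic K1 Y1) by (apply hK1; rewrite eY1', eY1; ring).
  assert (kZ1 : on_conic K1 Z1) by (apply hK1; rewrite eZ1, eZ1'; ring).
  assert (kX2 : on_conic K1 X2) by (apply hK1; rewrite eX2', eX2; ring).
  assert (kY2 : on_conic K1 Y2) by (apply hK1; rewrite eY2, eY2'; ring).
  assert (kZ2 : on_conic K1 Z2) by (apply hK1; rewrite eZ2', eZ2; ring).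
  assert (hcol : forall P Q T, collinear P Q T ->
    (p * z P - y P) * ((q * x Q - z Q) * (r * y T - x T)
                       - (r * y Q - x Q) * (q * x T - z T))
    + (q * x P - z P) * ((r * y Q - x Q) * (p * z T - y T)
                         - (p * z Q - y Q) * (r * y T - x T))
    + (r * y P - x P) * ((p * z Q - y Q) * (q * x T - z T)
                         - (q * x Q - z Q) * (p * z T - y T)) = 0).
  { intros P Q T hc'; apply (collinear_aff f), collinear_det in hc'.
    apply (Rmult_eq_reg_l (l1 * l2 * l3)); [| apply Rgt_not_eq; repeat apply pos; lra].
    rewrite Rmult_0_r, <- (Rmult_0_r (n ^ 3)), <- hc'.
    transitivity
      ((n * fst (aff f P)) * ((n * snd (aff f Q)) * (n * third (aff f T))
          - (n * third (aff f Q)) * (n * snd (aff f T)))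
       + (n * snd (aff f P)) * ((n * third (aff f Q)) * (n * fst (aff f T))
          - (n * fst (aff f Q)) * (n * third (aff f T)))
       + (n * third (aff f P)) * ((n * fst (aff f Q)) * (n * snd (aff f T))
          - (n * snd (aff f Q)) * (n * fst (aff f T)))); [| ring].
    rewrite !hf1, !hf2, !hf3; ring. }
  assert (nc1 : ~ collinear X1 Y1 Z1).
  { intros hc'; apply hcol in hc'.
    pose proof (hsum X1) as sX; pose proof (hsum Y1) as sY; pose proof (hsum Z1) as sZ.
    rewrite eX1, eX1' in sX; rewrite eY1', eY1 in sY; rewrite eZ1, eZ1' in sZ.
    rewrite eX1, eX1', eY1', eY1, eZ1, eZ1' in hc'.
    (* Each vertex lies on two of the three lines, so the determinant is a single product; a zero
       factor would make all three coordinates of a vertex vanish, against [hsum]. *)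
    assert (e : n ^ 3 * (y X1 * z Y1 * x Z1) = 0).
    { rewrite <- hc'; unfold n; ring. }
    apply Rmult_integral in e; destruct e as [e | e].
    { revert e; apply pow_nonzero; lra. }
    apply Rmult_integral in e; destruct e as [e | e];
      [apply Rmult_integral in e; destruct e as [e | e] |].
    - rewrite e in sX; lra.
    - rewrite e in sY; lra.
    - rewrite e in sZ; lra. }
  assert (nc2 : ~ collinear X2 Y2 Z2).
  { intros hc'; apply hcol in hc'.
    pose proof (hsum X2) as sX; pose proof (hsum Y2) as sY; pose proof (hsum Z2) as sZ.
    rewrite eX2', eX2 in sX; rewrite eY2, eY2' in sY; rewrite eZ2', eZ2 in sZ.
    rewrite eX2', eX2, eY2, eY2', eZ2', eZ2 in hc'.
    assert (e : n ^ 3 * (z X2 * x Y2 * y Z2) = 0).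
    { rewrite <- hc'; unfold n; ring. }
    apply Rmult_integral in e; destruct e as [e | e].
    { revert e; apply pow_nonzero; lra. }
    apply Rmult_integral in e; destruct e as [e | e];
      [apply Rmult_integral in e; destruct e as [e | e] |].
    - rewrite e in sX; lra.
    - rewrite e in sY; lra.
    - rewrite e in sZ; lra. }
  destruct (noncollinear_ne _ _ _ nc1) as [nXY1 [nYZ1 nZX1]].
  destruct (noncollinear_ne _ _ _ nc2) as [nXY2 [nYZ2 nZX2]].
  assert (hpor : porism3 K1 K2).
  { apply porism3_pullback, circumconic_inconic_porism; assumption. }
  exists K1, K2.
  split; [tauto |].
  split.
  { split; [apply tA1; trivial; rewrite yA, zA; ring |].
    split; [apply tA2; trivial; rewrite yA, zA; ring |].
    split; [apply tB1; trivial; rewrite zB, xB; ring |].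
    split; [apply tB2; trivial; rewrite zB, xB; ring |].
    split; [apply tC1 | apply tC2]; trivial; rewrite xC, yC; ring. }
  split; [apply cycle3_chain; trivial; [apply tC1 | apply tA1 | apply tB1]; trivial |].
  split; [apply cycle3_chain; trivial; [apply tC2 | apply tA2 | apply tB2]; trivial |].
  split; [exact hpor |].
  destruct (circumconic_points a b c h1 hinf) as [g [ginj gK]].
  apply (porism3_infinite K1 K2 (fun k => aff_inv f (g k)) hpor).
  - intros k m e; apply ginj; rewrite <- (aff_invK f (g k)), e; apply aff_invK.
  - intros k; apply on_conic_pullback; rewrite aff_invK; apply gK.
Qed.

(** * Trilinear coordinates of a triangle *)

(* The signed distance from T to the line PQ, divided by [area2 P Q V], which
   takes the same value for the three sides of a triangle. *)
Definition trilinear (P Q V T : point) : R :=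
  area2 P Q T / (area2 P Q V * side_len P Q).

Lemma trilinear_left (P Q V : point) : trilinear P Q V P = 0.
Proof. unfold trilinear, area2, Rdiv; ring. Qed.

Lemma trilinear_right (P Q V : point) : trilinear P Q V Q = 0.
Proof. unfold trilinear, area2, Rdiv; ring. Qed.

(** Trilinear coordinates are affine functions, so a linear relation at two points persists along
    their line; this extends the trisector equations from two points to the whole line. *)
Lemma trilinear_line (U V W U' V' W' : point) (k : R) (P Q T : point) :
  P <> Q -> line P Q T ->
  trilinear U V W P = k * trilinear U' V' W' P ->
  trilinear U V W Q = k * trilinear U' V' W' Q ->
  trilinear U V W T = k * trilinear U' V' W' T.
Proof.
  intros hPQ hT eP eQ.
  destruct (collinear_param _ _ _ hPQ hT) as [s [e1 e2]].
  assert (aff_T : forall U V W, trilinear U V W T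
    = (1 - s) * trilinear U V W P + s * trilinear U V W Q).
  { intros U0 V0 W0; unfold trilinear, area2, Rdiv; rewrite e1, e2; ring. }
  rewrite !aff_T, eP, eQ; ring.
Qed.

(** At the point of [PQ] with parameter [t] the two trilinears are [(1 - t) / |QV|] and [t / |VP|],
    which turns the law-of-sines ratio into an equation such as [y = p z]. *)
Lemma trisectors_trilinear (V P Q T1 T2 : point) :
  ~ collinear V P Q -> trisectors V P Q T1 T2 ->
  V <> T1 /\ V <> T2 /\
  trilinear Q V P T1 = 2 * cos (angle P V Q / 3) * trilinear V P Q T1 /\
  trilinear V P Q T2 = 2 * cos (angle P V Q / 3) * trilinear Q V P T2.
Proof.
  intros h htri.
  destruct (trisectorsP _ _ _ _ _ h htri) as [[t [a1 [a2 a3]]] [s [b1 [b2 b3]]]].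
  destruct (noncollinear_ne _ _ _ h) as [nP [_ nQ]].
  pose proof (side_len_pos _ _ nP) as dP; pose proof (side_len_pos _ _ nQ) as dQ.
  rewrite (side_len_sym V Q) in *.
  assert (hS : area2 V P Q <> 0) by exact h.
  assert (eS : area2 Q V P = area2 V P Q) by (unfold area2; ring).
  set (k := 2 * cos (angle P V Q / 3)) in *.
  assert (nT : forall T t, fst T = (1 - t) * fst P + t * fst Q ->
    snd T = (1 - t) * snd P + t * snd Q -> V <> T).
  { intros T t' e1 e2 e; apply hS; unfold area2; rewrite e, e1, e2; ring. }
  assert (e1 : forall T t, fst T = (1 - t) * fst P + t * fst Q ->
    snd T = (1 - t) * snd P + t * snd Q ->
    trilinear Q V P T = (1 - t) / side_len Q V /\ trilinear V P Q T = t / side_len V P).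
  { intros T t' e1 e2; unfold trilinear; rewrite eS.
    replace (area2 Q V T) with ((1 - t') * area2 V P Q)
      by (unfold area2; rewrite e1, e2; ring).
    replace (area2 V P T) with (t' * area2 V P Q)
      by (unfold area2; rewrite e1, e2; ring).
    split; field; split; try assumption; lra. }
  destruct (e1 _ _ a1 a2) as [-> ->]; destruct (e1 _ _ b1 b2) as [-> ->].
  split; [exact (nT _ _ a1 a2) |]; split; [exact (nT _ _ b1 b2) |]; split.
  - apply (Rmult_eq_reg_r (side_len V P * side_len Q V)); [| apply Rgt_not_eq; nra].
    transitivity ((1 - t) * side_len V P); [field; lra |].
    rewrite a3; field; lra.
  - apply (Rmult_eq_reg_r (side_len V P * side_len Q V)); [| apply Rgt_not_eq; nra].
    transitivity (s * side_len Q V); [field; lra |].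
    rewrite b3; field; lra.
Qed.

Lemma trilinear_sum (A B C T : point) :
  ~ collinear A B C ->
  side_len B C * trilinear B C A T + side_len C A * trilinear C A B T
    + side_len A B * trilinear A B C T = 1.
Proof.
  intros h; destruct (noncollinear_ne _ _ _ h) as [n1 [n2 n3]].
  pose proof (side_len_pos _ _ n1); pose proof (side_len_pos _ _ n2).
  pose proof (side_len_pos _ _ n3).
  assert (hS : area2 A B C <> 0) by exact h.
  unfold trilinear.
  replace (area2 B C A) with (area2 A B C) by (unfold area2; ring).
  replace (area2 C A B) with (area2 A B C) by (unfold area2; ring).
  transitivity ((area2 B C T + area2 C A T + area2 A B T) / area2 A B C);
    [field; lra |].
  replace (area2 B C T + area2 C A T + area2 A B T) with (area2 A B C)
    by (unfold area2; ring).
  field; exact hS.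
Qed.

(** The determinant is [k l (p q b + q c + a) / (a b c S)], with [S] twice the signed area of [ABC];
    the sum in the numerator is positive. *)
Lemma trilinear_affine_iso (A B C : point) (p q k l : R) :
  ~ collinear A B C -> 0 < p -> 0 < q -> k <> 0 -> l <> 0 ->
  exists f : affine_iso, forall T,
    fst (aff f T) = k * (p * trilinear A B C T - trilinear C A B T) /\
    snd (aff f T) = l * (q * trilinear B C A T - trilinear A B C T).
Proof.
  intros h hp hq hk hl; destruct (noncollinear_ne _ _ _ h) as [n1 [n2 n3]].
  pose proof (side_len_pos _ _ n1) as dc; pose proof (side_len_pos _ _ n2) as da.
  pose proof (side_len_pos _ _ n3) as db.
  assert (hS : area2 A B C <> 0) by exact h.
  set (gx := fun P Q V => - (snd Q - snd P) / (area2 P Q V * side_len P Q)).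
  set (gy := fun P Q V => (fst Q - fst P) / (area2 P Q V * side_len P Q)).
  set (g0 := fun P Q V => (fst P * snd Q - snd P * fst Q)
                          / (area2 P Q V * side_len P Q)).
  assert (hg : forall P Q V T, trilinear P Q V T
    = gx P Q V * fst T + gy P Q V * snd T + g0 P Q V).
  { intros P Q V T; unfold trilinear, gx, gy, g0, Rdiv.
    set (i := / (area2 P Q V * side_len P Q)); unfold area2; ring. }
  assert (hdet : k * (p * gx A B C - gx C A B) * (l * (q * gy B C A - gy A B C))
    - k * (p * gy A B C - gy C A B) * (l * (q * gx B C A - gx A B C)) <> 0).
  { unfold gx, gy.
    replace (area2 B C A) with (area2 A B C) by (unfold area2; ring).
    replace (area2 C A B) with (area2 A B C) by (unfold area2; ring).
    set (S := area2 A B C) in *.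
    set (a := side_len B C) in *; set (b := side_len C A) in *; set (c := side_len A B) in *.
    match goal with |- ?e <> 0 =>
      replace e with (k * l * ((p * q * b + q * c + a) / (a * b * c)) / S) end.
    - assert (0 < (p * q * b + q * c + a) / (a * b * c)).
      { apply Rdiv_lt_0_compat; [| repeat apply Rmult_lt_0_compat; lra].
        assert (0 < p * q * b) by (repeat apply Rmult_lt_0_compat; lra).
        assert (0 < q * c) by (apply Rmult_lt_0_compat; lra); lra. }
      unfold Rdiv at 1.
      apply Rmult_integral_contrapositive_currified;
        [| apply Rinv_neq_0_compat, hS].
      apply Rmult_integral_contrapositive_currified; [| lra].
      apply Rmult_integral_contrapositive_currified; assumption.
    - transitivity (k * l * ((p * q * b + q * c + a) * S / (a * b * c)) / (S * S));
        [field; repeat split; try assumption; lra |].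
      unfold S at 1, area2; field; repeat split; try assumption; lra. }
  exists (AffineIso _ _ (k * (p * g0 A B C - g0 C A B)) _ _
            (l * (q * g0 B C A - g0 A B C)) hdet).
  intros T; unfold aff; cbn [fst snd m11 m12 m21 m22 v1 v2].
  rewrite !hg; split; ring.
Qed.

(** * From the trisectors to the normalized conics *)

Theorem mainTheorem2
  (A B C A1 A2 B1 B2 C1 C2 X1 Y1 Z1 X2 Y2 Z2 : point)
  (hABC : ~ collinear A B C)
  (hA : trisectors A B C A1 A2)
  (hB : trisectors B C A B1 B2)
  (hC : trisectors C A B C1 C2)
  (hX1 : line B B1 X1 /\ line C C1 X1)
  (hY1 : line A A1 Y1 /\ line C C1 Y1)
  (hZ1 : line A A1 Z1 /\ line B B1 Z1)
  (hX2 : line B B2 X2 /\ line C C2 X2)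
  (hY2 : line A A2 Y2 /\ line C C2 Y2)
  (hZ2 : line A A2 Z2 /\ line B B2 Z2) :
  exists K1 K2 : conic,
    (on_conic K1 X1 /\ on_conic K1 Y1 /\ on_conic K1 Z1 /\
     on_conic K1 X2 /\ on_conic K1 Y2 /\ on_conic K1 Z2) /\
    (touches A A1 K2 /\ touches A A2 K2 /\
     touches B B1 K2 /\ touches B B2 K2 /\
     touches C C1 K2 /\ touches C C2 K2) /\
    (poncelet_chain K1 K2 (cycle3 X1 Y1 Z1) /\
     closes_up 3 (cycle3 X1 Y1 Z1)) /\
    (poncelet_chain K1 K2 (cycle3 X2 Y2 Z2) /\
     closes_up 3 (cycle3 X2 Y2 Z2)) /\
    (forall P0 : point, on_conic K1 P0 ->
       (exists P : nat -> point, poncelet_chain K1 K2 P /\ P 0%nat = P0) /\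
       (forall P : nat -> point, poncelet_chain K1 K2 P -> P 0%nat = P0 ->
          closes_up 3 P)) /\
    ~ Finite (Ensemble point) (poncelet_triangles K1 K2).
Proof.
  assert (hBCA : ~ collinear B C A)
    by (intros h; apply hABC, collinear_rot, collinear_rot, h).
  assert (hCAB : ~ collinear C A B) by (intros h; apply hABC, collinear_rot, h).
  destruct (trisectors_trilinear _ _ _ _ _ hABC hA) as [nA1 [nA2 [eA1 eA2]]].
  destruct (trisectors_trilinear _ _ _ _ _ hBCA hB) as [nB1 [nB2 [eB1 eB2]]].
  destruct (trisectors_trilinear _ _ _ _ _ hCAB hC) as [nC1 [nC2 [eC1 eC2]]].
  pose proof (angle_pos_lt_PI B A C hABC) as bA.
  pose proof (angle_pos_lt_PI C B A hBCA) as bB.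
  pose proof (angle_pos_lt_PI A C B hCAB) as bC.
  pose proof (triangle_angle_sum A B C hABC) as hsum.
  assert (hadm : admissible (2 * cos (angle B A C / 3)) (2 * cos (angle C B A / 3))
                   (2 * cos (angle A C B / 3)))
    by (apply trisected_admissible; lra).
  set (p := 2 * cos (angle B A C / 3)) in *.
  set (q := 2 * cos (angle C B A / 3)) in *.
  set (r := 2 * cos (angle A C B / 3)) in *.
  clearbody p q r.
  destruct (noncollinear_ne _ _ _ hABC) as [nAB [nBC nCA]].
  pose proof (side_len_pos _ _ nAB) as dc; pose proof (side_len_pos _ _ nBC) as da.
  pose proof (side_len_pos _ _ nCA) as db.
  pose proof (fun T => trilinear_sum A B C T hABC) as hS.
  assert (hp : 1 < p) by apply hadm.
  assert (hq : 1 < q) by apply hadm.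
  assert (hr : 1 < r) by apply hadm.
  assert (hpq : 1 < p * q) by nra.
  assert (hn : 0 < p * q * r - 1) by nra.
  set (a := side_len B C) in *; set (b := side_len C A) in *; set (c := side_len A B) in *.
  set (l1 := b + r * a + q * r * c); set (l2 := c + p * b + r * p * a).
  assert (hl1 : 0 < l1).
  { assert (0 < q * r * c) by (repeat apply Rmult_lt_0_compat; lra).
    assert (0 < r * a) by (apply Rmult_lt_0_compat; lra); unfold l1; lra. }
  assert (hl2 : 0 < l2).
  { assert (0 < r * p * a) by (repeat apply Rmult_lt_0_compat; lra).
    assert (0 < p * b) by (apply Rmult_lt_0_compat; lra); unfold l2; lra. }
  (* With this scaling the side forms of [X1 Y1 Z1] become barycentric coordinates, that is, they
     sum to 1. *)
  destruct (trilinear_affine_iso A B C p q (l1 / (p * q * r - 1))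
              (l2 / (p * q * r - 1)) hABC) as [f hf].
  { lra. }
  { lra. }
  { apply Rgt_not_eq, Rdiv_lt_0_compat; assumption. }
  { apply Rgt_not_eq, Rdiv_lt_0_compat; assumption. }
  assert (onA1 : forall T, line A A1 T ->
    trilinear C A B T = p * trilinear A B C T).
  { intros T hT; apply (trilinear_line _ _ _ _ _ _ p A A1); trivial.
    rewrite trilinear_right, trilinear_left; ring. }
  assert (onA2 : forall T, line A A2 T ->
    trilinear A B C T = p * trilinear C A B T).
  { intros T hT; apply (trilinear_line _ _ _ _ _ _ p A A2); trivial.
    rewrite trilinear_right, trilinear_left; ring. }
  assert (onB1 : forall T, line B B1 T ->
    trilinear A B C T = q * trilinear B C A T).
  { intros T hT; apply (trilinear_line _ _ _ _ _ _ q B B1); trivial.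
    rewrite trilinear_right, trilinear_left; ring. }
  assert (onB2 : forall T, line B B2 T ->
    trilinear B C A T = q * trilinear A B C T).
  { intros T hT; apply (trilinear_line _ _ _ _ _ _ q B B2); trivial.
    rewrite trilinear_right, trilinear_left; ring. }
  assert (onC1 : forall T, line C C1 T ->
    trilinear B C A T = r * trilinear C A B T).
  { intros T hT; apply (trilinear_line _ _ _ _ _ _ r C C1); trivial.
    rewrite trilinear_right, trilinear_left; ring. }
  assert (onC2 : forall T, line C C2 T ->
    trilinear C A B T = r * trilinear B C A T).
  { intros T hT; apply (trilinear_line _ _ _ _ _ _ r C C2); trivial.
    rewrite trilinear_right, trilinear_left; ring. }
  destruct (trilinear_porism (trilinear B C A) (trilinear C A B) (trilinear A B C)
    a b c p q r f A B C A1 A2 B1 B2 C1 C2 X1 Y1 Z1 X2 Y2 Z2 hadm da db dc hS)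
    as [K1 [K2 [hon [htan [hch1 [hch2 [hpor hinf]]]]]]];
    try apply trilinear_left; try apply trilinear_right; trivial;
    try (apply onA1; tauto); try (apply onA2; tauto); try (apply onB1; tauto);
    try (apply onB2; tauto); try (apply onC1; tauto); try (apply onC2; tauto).
  { intros T; rewrite (proj1 (hf T)); fold l1; field; lra. }
  { intros T; rewrite (proj2 (hf T)); fold l2; field; lra. }
  exists K1, K2.
  split; [exact hon |]; split; [exact htan |].
  split; [split; [exact hch1 | reflexivity] |].
  split; [split; [exact hch2 | reflexivity] |].
  split; [| exact hinf].
  intros P0 hP0; split.
  (* Existence: the Poncelet triangle at [P0], traversed periodically. *)
  - destruct (hpor P0 hP0) as [Q [T [kQ [kT [hcol [t1 [t2 [t3 _]]]]]]]].
    exists (cycle3 P0 Q T); split; [| reflexivity].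
    apply cycle3_chain; assumption.
  - intros P hP _; exact (porism3_closes K1 K2 P hpor hP).
Qed.
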